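(* For every $n\in\mathbb N$ and every normed space $\mathbf X=(\mathbb R^n,\|\cdot\|_{\mathbf X})$, the metric $\mathfrak d$ on $\mathbb R^n$ that is defined by $$\forall x,y\in\mathbb R^n,\qquad\mathfrak d(x,y)=\frac{4\|x-y\|_{\Pi^*\mathbf X}}{\mathrm{vol}_n(B_{\mathbf X})}$$ is a separation profile for $\mathbf X$.
   Context: $B_{\mathbf X}$ is the closed unit ball of $\mathbf X$. The norm $\|\cdot\|_{\Pi^*\mathbf X}$ on $\mathbb R^n$ (whose unit ball is the polar projection body of $B_{\mathbf X}$) is given for $x\ne0$ by $\|x\|_{\Pi^*\mathbf X}=\frac12\int_{\partial B_{\mathbf X}}|\langle x,N(y)\rangle|\,dy=\mathrm{vol}_{n-1}(\mathrm{Proj}_{x^\perp}B_{\mathbf X})\|x\|_{\ell_2^n}$, where $N(y)$ is the (almost everywhere defined) unit outer normal to $\partial B_{\mathbf X}$ at $y$, integration is with respect to surface area, and $\mathrm{Proj}_{x^\perp}$ is the orthogonal projection onto $x^\perp$. A random partition $\mathscr P$ of a metric space $(\mathcal M,d_{\mathcal M})$ consists of a probability space $(\Omega,\mathbf{Prob})$ and set-valued mappings $\Gamma^k:\Omega\to2^{\mathcal M}$, $k\in\mathbb N$, such that $\mathscr P^\omega=\{\Gamma^k(\omega)\}_{k=1}^\infty$ is a partition of $\mathcal M$ for every $\omega\in\Omega$ (empty clusters are allowed) and each $\Gamma^k$ is strongly measurable, i.e., $\{\omega:\ E\cap\Gamma^k(\omega)\neq\emptyset\}$ is $\mathbf{Prob}$-measurable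 for every closed $E\subseteq\mathcal M$. $\mathscr P(x)$ denotes the cluster containing $x$. $\mathscr P$ is $\Delta$-bounded if every cluster of $\mathscr P^\omega$ has $d_{\mathcal M}$-diameter at most $\Delta$, for every $\omega$; for a normed space $\mathbf X=(\mathbb R^n,\|\cdot\|_{\mathbf X})$ the diameter is with respect to $\|\cdot\|_{\mathbf X}$. A metric $\mathfrak d:\mathcal M\times\mathcal M\to[0,\infty)$ is a separation profile of $(\mathcal M,d_{\mathcal M})$ if for every $\Delta>0$ there is a $\Delta$-bounded random partition $\mathscr P_\Delta$ of $(\mathcal M,d_{\mathcal M})$, defined on some probability space $(\Omega_\Delta,\mathbf{Prob}_\Delta)$, such that $\mathfrak d(x,y)\ge\sup_{\Delta\in(0,\infty)}\Delta\,\mathbf{Prob}_\Delta[\mathscr P_\Delta(x)\ne\mathscr P_\Delta(y)]$ for all $x,y\in\mathcal M$. *)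

(* Defs.v *)
From HB Require Import structures.
From mathcomp Require Import all_boot all_order all_algebra.
From mathcomp Require Import all_classical all_reals all_analysis.

Set Implicit Arguments.
Unset Strict Implicit.
Unset Printing Implicit Defensive.

Import Order.TTheory GRing.Theory Num.Theory.
Import numFieldNormedType.Exports.

Local Open Scope classical_set_scope.
Local Open Scope ring_scope.

(* n-dimensional Lebesgue measure is built as the n-fold product of the
   one-dimensional [lebesgue_measure]: [cons_measure m] is the product measure
   of [lebesgue_measure] and [m], carried over to tuples by
   (x, (x1, .., xn)) |-> (x, x1, .., xn). Its sigma-finiteness, needed to
   iterate, is proved by hand because the library's sigma-finiteness instance
   for binary products is not found by canonical structure inference. *)
Section cons_measure.
Variables (R : realType) (n : nat).
Local Notation mR := (measurableTypeR R).
Variable m : {sigma_finite_measure set (n.-tuple mR) -> \bar R}.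

Definition cons_pair (p : mR * n.-tuple mR) : n.+1.-tuple mR :=
  [the n.+1.-tuple mR of p.1 :: p.2].

Lemma measurable_cons_pair : measurable_fun setT cons_pair.
Proof. exact: measurable_cons. Qed.

Definition cons_measure : set (n.+1.-tuple mR) -> \bar R :=
  pushforward (lebesgue_measure \x m)%E cons_pair.

Let cons_measure0 : cons_measure set0 = 0%E.
Proof. by rewrite /cons_measure /pushforward preimage_set0 measure0. Qed.

Let cons_measure_ge0 A : (0 <= cons_measure A)%E.
Proof. exact: (measure_ge0 (lebesgue_measure \x m)%E). Qed.

Let cons_measure_sigma_additive : semi_sigma_additive cons_measure.
Proof.
apply: measure_semi_sigma_additive; exact: measurable_cons_pair.
Qed.

HB.instance Definition _ := isMeasure.Build _ _ _ cons_measure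
  cons_measure0 cons_measure_ge0 cons_measure_sigma_additive.

Let cons_measure_sigma_finite : sigma_finite setT cons_measure.
Proof.
have /sigma_finiteP[F [TF ndF Foo]] := sigma_finiteT (@lebesgue_measure R).
have /sigma_finiteP[G [TG ndG Goo]] := sigma_finiteT m.
pose hd (t : n.+1.-tuple mR) : mR := tnth t ord0.
pose tl (t : n.+1.-tuple mR) : n.-tuple mR := [tuple of behead t].
exists (fun k => hd @^-1` F k `&` tl @^-1` G k).
  apply/esym; rewrite -subTset => t _.
  have : setT (hd t) by []. have : setT (tl t) by [].
  rewrite TF TG => -[j _ Gj] [i _ Fi]; exists (maxn i j) => //; split.
  - exact: (subsetPset _ _ (ndF _ _ (leq_maxl i j))).
  - exact: (subsetPset _ _ (ndG _ _ (leq_maxr i j))).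
move=> k; have [mF Fk] := Foo k; have [mG Gk] := Goo k; split.
  apply: measurableI.
  - by rewrite -[X in measurable X]setTI; exact: (measurable_tnth ord0).
  - by rewrite -[X in measurable X]setTI; exact: (@measurable_behead _ mR).
rewrite /cons_measure /pushforward (_ : _ @^-1` _ = F k `*` G k).
  by rewrite product_measure1E// lte_mul_pinfty// ge0_fin_numE.
apply/seteqP; split=> -[x t] [/= Fx Gt]; split=> //.
- by move: Gt; rewrite (_ : tl _ = t)//; exact/val_inj.
- by rewrite (_ : tl _ = t)//; exact/val_inj.
Qed.

HB.instance Definition _ := Measure_isSigmaFinite.Build _ _ _ cons_measure
  cons_measure_sigma_finite.

End cons_measure.

Fixpoint lebesgue_tuple (R : realType) n :
    {sigma_finite_measure set (n.-tuple (measurableTypeR R)) -> \bar R} :=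
  match n with
  | 0 => \d_([tuple] : 0.-tuple (measurableTypeR R))
  | n'.+1 => cons_measure (lebesgue_tuple R n')
  end.

Section euclidean.
Variables (R : realType) (n : nat).
Implicit Types (u v x : 'rV[R]_n) (A : set 'rV[R]_n).

Definition vol A : \bar R :=
  lebesgue_tuple R n [set t | A (\row_i tnth t i)].

Definition dotp u v : R := \sum_(i < n) u ord0 i * v ord0 i.

Definition l2norm x : R := Num.sqrt (dotp x x).

Definition orth_proj x v : 'rV[R]_n := v - (dotp v x / dotp x x) *: x.

End euclidean.

Section hyperplane_volume.
Variables (R : realType) (n : nat).
Implicit Types (x : 'rV[R]_n.+1) (A : set 'rV[R]_n.+1).

(* The rows of [perp_frame x] are, for x <> 0, an orthonormal basis of the
   hyperplane orthogonal to x. *)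
Definition perp_frame x : 'M[R]_(n, n.+1) :=
  xget 0 [set U | U *m U^T = 1%:M /\ U *m x^T = 0].

(* The n-dimensional volume of A, for A contained in the hyperplane orthogonal
   to x <> 0: Lebesgue measure of A in orthonormal coordinates. It does not
   depend on the chosen orthonormal basis. *)
Definition vol_perp x A : \bar R :=
  vol [set t : 'rV[R]_n | A (t *m perp_frame x)].

End hyperplane_volume.

Definition is_norm (R : realType) (n : nat) (N : 'rV[R]_n -> R) : Prop :=
  [/\ forall x y, N (x + y) <= N x + N y,
      forall a x, N (a *: x) = `|a| * N x
    & forall x, N x = 0 -> x = 0].

Definition unit_ball (R : realType) (n : nat) (N : 'rV[R]_n -> R) :
  set 'rV[R]_n := [set x | N x <= 1].

(* The norm whose unit ball is the polar projection body of [unit_ball N],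
   given by the volumes of the hyperplane projections of [unit_ball N]. The
   volume is finite, so that [fine] loses nothing, and the value at 0 is 0
   because of the factor [l2norm x]. *)
Definition polar_projection_norm (R : realType) (n : nat)
    (N : 'rV[R]_n.+1 -> R) (x : 'rV[R]_n.+1) : R :=
  fine (vol_perp x (orth_proj x @` unit_ball N)) * l2norm x.

Section separation_profile.
Variables (R : realType) (M : Type).
Implicit Types (d dM : M -> M -> R).

Definition is_metric d : Prop :=
  [/\ forall x y, 0 <= d x y,
      forall x y, d x y = 0 <-> x = y,
      forall x y, d x y = d y x
    & forall x y z, d x z <= d x y + d y z].

Definition metric_closed dM (E : set M) : Prop :=
  forall x, (forall e : R, 0 < e -> exists2 y, E y & dM x y < e) -> E x.

Definition metric_diam dM (A : set M) : \bar R :=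
  ereal_sup [set (dM p.1 p.2)%:E | p in A `*` A].

Record random_partition dM := RandomPartition {
  rp_display : measure_display;
  rp_space : measurableType rp_display;
  rp_prob : probability rp_space R;
  cluster : nat -> rp_space -> set M;
  cluster_cover : forall w, \bigcup_k cluster k w = setT;
  cluster_disjoint : forall w, trivIset setT (fun k => cluster k w);
  cluster_measurable : forall k (E : set M), metric_closed dM E ->
    measurable [set w | E `&` cluster k w !=set0]
}.

Definition cluster_at dM (P : random_partition dM) (w : rp_space P) (x : M) :
  set M := \bigcup_(k in [set k | cluster k w x]) cluster k w.

Definition bounded_partition dM (Delta : R) (P : random_partition dM) : Prop :=
  forall w k, (metric_diam dM (cluster (r := P) k w) <= Delta%:E)%E.

Definition separation_profile dM d : Prop :=
  is_metric d /\
  exists P : {posnum R} -> random_partition dM,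
    (forall Delta, bounded_partition Delta%:num (P Delta)) /\
    forall x y, (ereal_sup [set Delta%:num%:E *
        rp_prob (P Delta) [set w | cluster_at w x <> cluster_at w y]
      | Delta in [set: {posnum R}]] <= (d x y)%:E)%E.

End separation_profile.

(* Main.v *)
Require Import Defs.
From HB Require Import structures.
From mathcomp Require Import all_boot all_order all_algebra.
From mathcomp Require Import all_classical all_reals all_analysis measurable_realfun.
From mathcomp Require Import lra ring.

Set Implicit Arguments.
Unset Strict Implicit.
Unset Printing Implicit Defensive.

Import Order.TTheory GRing.Theory Num.Theory.
Import numFieldNormedType.Exports.

Local Open Scope classical_set_scope.
Local Open Scope ring_scope.

(** Let B be the unit ball of N and p the polar projection norm: p(x) is the
volume of the shadow of B on the hyperplane orthogonal to x, times |x|. Both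
halves of the theorem rest on comparing p(x) with V(x), the volume of the part
of B + x that lies outside B.

Slice along the direction x, in orthonormal coordinates ([vol_along]). A line
that meets B contributes at most |x| to V(x), so V(x) <= p(x)
([vol_ball_diff_le]). Over a slightly shrunk shadow the chords of B are longer
than a small shift, and such lines contribute exactly the length of the shift,
so V(tau x) >= tau p(x) (1 - tau N(x))^n ([vol_ball_diff_ge]). As V is
subadditive, tau -> 0 gives the triangle inequality for p ([polarD]), hence the
metric.

For the partition of diameter Delta, let r = Delta/2 and let L be so large that
the translates of an r-ball by the lattice L Z^m are disjoint. Draw independent
X_0, X_1, .. uniformly in the unit cell. The clusters are the r-balls centred at
the points L (X_k + z), each minus all the balls of smaller k. Let q be the
probability that x and y are separated. Either the first draw already puts one
of x, y in a ball without the other, or it puts neither of them in a ball and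
the remaining draws, which are distributed as the whole sequence, separate
them; otherwise both are in the same ball and never separated. So q times the
probability that the first draw hits x or y is at most the probability that it
puts one of them in a ball without the other ([renewal_bound]). The former is at least
vol(rB) / L^m and the latter at most the volume of the symmetric difference of
two r-balls over L^m, so that q <= 2 p(x - y) / (r vol B), which is
4 p(x - y) / (Delta vol B) ([exists_separating_partition]).

The probability space is [0, 1[ with its uniform law. The even and the odd
binary digits of a uniform number are two independent uniform numbers
([unif_bits]), so one number splits into a uniform vector and an independent
uniform number ([unif_split_vector]), and iterating the splitting yields the
whole sequence of draws. The law of that first splitting is all that the renewal
argument uses.

Rotation invariance of volume follows from translation invariance by a Tonelli
argument ([vol_additive_preimage]), orthonormal frames come from a Householder
reflection, and the strong measurability of the clusters comes from compactness
([measurable_hitting]). *)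

(** * Row vectors as a measurable space, and volume as a measure on them *)

Section row_measurable.
Variables (R : realType) (n : nat).
Local Notation mR := (measurableTypeR R).
Local Notation V := 'rV[R]_n.

Definition row_of_tuple (t : n.-tuple mR) : V := \row_i tnth t i.
Definition tuple_of_row (v : V) : n.-tuple mR := [tuple v ord0 i | i < n].

Lemma row_of_tupleK : cancel row_of_tuple tuple_of_row.
Proof. by move=> t; apply: eq_from_tnth => i; rewrite tnth_mktuple mxE. Qed.

Lemma tuple_of_rowK : cancel tuple_of_row row_of_tuple.
Proof. by move=> v; apply/rowP => i; rewrite mxE tnth_mktuple. Qed.

(** The transport of the product sigma-algebra of tuples, so that [vol] is a
    pushforward and hence a measure. *)
Definition row_measurable : set (set V) :=
  [set A | measurable (row_of_tuple @^-1` A)].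

Let row_measurable0 : row_measurable set0.
Proof. by rewrite /row_measurable/= preimage_set0. Qed.

Let row_measurableC A : row_measurable A -> row_measurable (~` A).
Proof. by rewrite /row_measurable/= preimage_setC; exact: measurableC. Qed.

Let row_measurable_bigcup (F : (set V)^nat) :
  (forall i, row_measurable (F i)) -> row_measurable (\bigcup_i F i).
Proof.
by move=> mF; rewrite /row_measurable/= preimage_bigcup; exact: bigcupT_measurable.
Qed.

HB.instance Definition _ := @isMeasurable.Build default_measure_display
  'rV[R]_n row_measurable row_measurable0 row_measurableC row_measurable_bigcup.

Lemma measurable_rowP d (S : measurableType d) (f : S -> V) :
  (forall i, measurable_fun setT (fun x => f x ord0 i : mR)) ->
  measurable_fun setT f.
Proof.
move=> mf.
have mt : measurable_fun setT (fun x => tuple_of_row (f x)).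
  apply/measurable_fun_tnthP => i.
  by apply: eq_measurable_fun (mf i) => x _ /=; rewrite tnth_mktuple.
move=> _ A mA; have := mt measurableT _ mA; rewrite setTI.
rewrite (_ : _ @^-1` _ = setT `&` f @^-1` A)// setTI.
by apply/seteqP; split => x /=; rewrite tuple_of_rowK.
Qed.

Lemma measurable_coord (i : 'I_n) :
  measurable_fun setT (fun v : V => v ord0 i : mR).
Proof.
move=> _ A mA; rewrite setTI /measurable/= /row_measurable/=.
have := measurable_tnth i measurableT mA; rewrite setTI.
by congr (measurable _); apply/seteqP; split => t /=; rewrite mxE.
Qed.

Lemma measurable_tuple_of_row : measurable_fun setT tuple_of_row.
Proof.
apply/measurable_fun_tnthP => i.
by apply: eq_measurable_fun (measurable_coord i) => x _ /=; rewrite tnth_mktuple.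
Qed.

Let vol0 : @vol R n set0 = 0%E.
Proof. by rewrite /vol measure0. Qed.

Let vol_ge0 (A : set V) : (0 <= vol A)%E.
Proof. exact: (measure_ge0 (lebesgue_tuple R n)). Qed.

Let vol_sigma_additive : semi_sigma_additive (@vol R n).
Proof.
move=> F mF tF mUF; rewrite /vol.
rewrite (_ : [set t | _] = \bigcup_k (row_of_tuple @^-1` F k)); last first.
  by rewrite -preimage_bigcup.
apply: (@measure_semi_sigma_additive _ _ _ (lebesgue_tuple R n)
  (fun k => row_of_tuple @^-1` F k)) => //.
- by move=> i j _ _ [t [Fi Fj]]; apply: (tF i j) => //; exists (row_of_tuple t).
Qed.

HB.instance Definition _ := isMeasure.Build _ _ _ (@vol R n)
  vol0 vol_ge0 vol_sigma_additive.

Let vol_sigma_finite : sigma_finite setT (@vol R n).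
Proof.
have /sigma_finiteP[F [TF ndF Foo]] := sigma_finiteT (lebesgue_tuple R n).
exists (fun k => tuple_of_row @^-1` F k).
  by rewrite -preimage_bigcup -TF preimage_setT.
move=> k; have [mF Fk] := Foo k; split.
  by rewrite -[X in measurable X]setTI; exact: measurable_tuple_of_row.
rewrite /vol (_ : [set t | _] = F k)//.
by apply/seteqP; split => t /=; rewrite row_of_tupleK.
Qed.

HB.instance Definition _ := Measure_isSigmaFinite.Build _ _ _ (@vol R n)
  vol_sigma_finite.

End row_measurable.

(** * Coordinatewise description of volume, and translation invariance *)

Section countable_quantifiers.
Context d (T : measurableType d) (I : countType).

Lemma measurable_exists (P : I -> T -> Prop) :
  (forall i, measurable [set x | P i x]) -> measurable [set x | exists i, P i x].
Proof.
move=> mP; rewrite (_ : [set x | _] = \bigcup_i [set x | P i x]).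
  exact: countable_bigcupT_measurable.
by apply/seteqP; split => x /= [i]; exists i.
Qed.

Lemma measurable_forall (P : I -> T -> Prop) :
  (forall i, measurable [set x | P i x]) -> measurable [set x | forall i, P i x].
Proof.
move=> mP; rewrite -[X in measurable X]setCK; apply: measurableC.
rewrite (_ : ~` _ = [set x | exists i, (~` [set x | P i x]) x]).
  by apply: measurable_exists => i; exact: measurableC.
by apply/seteqP; split => x /=; [move/existsNP|move=> h; exact/existsNP].
Qed.

End countable_quantifiers.

Section row_cons.
Variables (R : realType) (n : nat).
Local Notation mR := (measurableTypeR R).

Definition row_cons (s : R) (v : 'rV[R]_n) : 'rV[R]_n.+1 :=
  row_mx (const_mx s : 'rV[R]_1) v.

Lemma row_cons0 s v : row_cons s v ord0 ord0 = s.
Proof.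
have -> : (ord0 : 'I_n.+1) = lshift n (ord0 : 'I_1) by exact/val_inj.
by apply: (etrans (row_mxEl _ _ _ _)); rewrite mxE.
Qed.

Lemma row_consS s v i : row_cons s v ord0 (lift ord0 i) = v ord0 i.
Proof.
have -> : lift ord0 i = rshift 1 i by exact/val_inj.
exact: row_mxEr.
Qed.

Lemma row_consP s v (P : 'I_n.+1 -> R -> Prop) :
  (forall i, P i (row_cons s v ord0 i)) <->
  P ord0 s /\ forall i, P (lift ord0 i) (v ord0 i).
Proof.
split=> [h|[h0 hS] i]; last first.
  by case: (unliftP ord0 i) => [j|] ->; rewrite ?row_cons0 ?row_consS.
by split=> [|i]; [have := h ord0; rewrite row_cons0|
  have := h (lift ord0 i); rewrite row_consS].
Qed.

Lemma row_consD s v s' v' :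
  row_cons s v + row_cons s' v' = row_cons (s + s') (v + v').
Proof. apply/rowP => i; rewrite mxE; case: (unliftP ord0 i) => [j|] ->.
  by rewrite !row_consS mxE.
by rewrite !row_cons0. Qed.

Lemma row_cons_eta (x : 'rV[R]_n.+1) :
  x = row_cons (x ord0 ord0) (\row_i x ord0 (lift ord0 i)).
Proof.
apply/rowP => i; case: (unliftP ord0 i) => [j|] ->.
  by rewrite row_consS mxE.
by rewrite row_cons0.
Qed.

Lemma measurable_row_cons :
  measurable_fun setT (fun p : mR * 'rV[R]_n => row_cons p.1 p.2).
Proof.
apply: measurable_rowP => i; case: (unliftP ord0 i) => [j|] ->.
  rewrite (_ : (fun x => _) = (fun v : 'rV[R]_n => v ord0 j : mR) \o snd).
    by apply: measurableT_comp; [exact: measurable_coord|exact: measurable_snd].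
  by apply/funext => p /=; rewrite row_consS.
rewrite (_ : (fun x => _) = fst); first exact: measurable_fst.
by apply/funext => p /=; rewrite row_cons0.
Qed.

(** Fubini form of the recursive definition of Lebesgue measure, free of tuples:
    the entry point for all inductions on the dimension. *)
Lemma vol_row_cons (A : set 'rV[R]_n.+1) : vol A =
  ((@lebesgue_measure R) \x (@vol R n))%E [set p | A (row_cons p.1 p.2)].
Proof.
rewrite /vol/= /cons_measure /pushforward /product_measure1.
apply: eq_integral => s _ /=; congr (lebesgue_tuple R n _).
have E t : \row_i tnth (cons_pair (s, t)) i = row_cons s (row_of_tuple t).
  by apply/rowP => i; rewrite mxE; case: (unliftP ord0 i) => [j|] ->;
    rewrite ?row_cons0 ?row_consS ?mxE ?tnthS ?tnth0.
apply/seteqP; split => t /=.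
  by move/xsectionP => /=; rewrite E => At; apply/xsectionP.
by move/xsectionP => At; apply/xsectionP; rewrite /= E.
Qed.

End row_cons.

Section image_measure.
Context d d' (T1 : measurableType d) (T2 : measurableType d') (R : realType).
Variables (m : {measure set T1 -> \bar R}) (f : T1 -> T2).
Hypothesis mf : measurable_fun [set: T1] f.

(** [pushforward] with the measurability proof as an argument, so that the
    measure structure is inferred from it. *)
Definition image_measure : set T2 -> \bar R := let _ := mf in pushforward m f.

Let image_measure0 : image_measure set0 = 0%E.
Proof. by rewrite /image_measure /pushforward preimage_set0 measure0. Qed.

Let image_measure_ge0 A : (0 <= image_measure A)%E.
Proof. exact: (measure_ge0 m). Qed.

Let image_measure_sigma_additive : semi_sigma_additive image_measure.
Proof. exact: measure_semi_sigma_additive. Qed.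

HB.instance Definition _ := isMeasure.Build _ _ _ image_measure
  image_measure0 image_measure_ge0 image_measure_sigma_additive.

End image_measure.

Section lebesgue_shift.
Variable R : realType.
Local Notation mR := (measurableTypeR R).
Local Notation mu := (@lebesgue_measure R).

Lemma lebesgue_measure_affine (c d : R) (A : set mR) : 0 < c -> measurable A ->
  mu [set s | A (c * s + d)] = (c^-1%:E * mu A)%E.
Proof.
move=> c0 mA.
pose f : mR -> mR := fun s => c * s + d.
have mf : measurable_fun setT f.
  by apply: measurable_funD => //; exact: measurable_funM.
have -> : mu A = mscale (NngNum (ltW c0)) (image_measure mu mf) A.
  apply: lebesgue_measure_unique => //= _ [[a b]] _ <-.
  rewrite /mscale/= /image_measure /pushforward.
  rewrite (_ : f @^-1` _ = `](a - d) / c, (b - d) / c]%classic); last first.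
    apply/seteqP; split => s /=; rewrite !in_itv/= /f ltr_pdivrMr// ler_pdivlMr//;
      rewrite ltrBlDr lerBrDr [c * s]mulrC//.
  rewrite !lebesgue_measure_itv/= !lte_fin ltr_pM2r ?invr_gt0// ltrD2r.
  case: ifPn => _; last by rewrite mule0.
  by rewrite -!EFinD -EFinM; congr EFin; field; rewrite gt_eqF.
rewrite /mscale/= muleA -EFinM mulVf ?gt_eqF// mul1e.
by [].
Qed.

Lemma lebesgue_measure_shift (d : R) (A : set mR) : measurable A ->
  mu [set s | A (s + d)] = mu A.
Proof.
move=> mA; have := lebesgue_measure_affine d ltr01 mA.
by rewrite invr1 mul1e; under eq_set do rewrite mul1r.
Qed.

End lebesgue_shift.

Section vol_translation.
Variable R : realType.
Local Notation mR := (measurableTypeR R).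

Lemma measurable_row_shift n (w : 'rV[R]_n) :
  measurable_fun setT (fun v : 'rV[R]_n => v + w).
Proof.
apply: measurable_rowP => i.
rewrite (_ : (fun x => _) = (fun v : 'rV[R]_n => (v ord0 i + w ord0 i) : mR)).
  by apply: measurable_funD => //; exact: measurable_coord.
by apply/funext => v; rewrite mxE.
Qed.

(** Induction on the dimension: shift the last coordinates inside each section,
    then the first one under the integral. *)
Lemma vol_shift n (w : 'rV[R]_n) (A : set 'rV[R]_n) : measurable A ->
  vol [set v | A (v + w)] = vol A.
Proof.
elim: n => [|n ih] in w A *.
  by move=> _; congr vol; apply/seteqP; split => v /=; congr A; apply/rowP => -[].
move=> mA; rewrite !vol_row_cons (row_cons_eta w).
set a := w ord0 ord0; set w' := \row_i _.
pose B := [set p : mR * 'rV[R]_n | A (row_cons p.1 p.2)].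
have mB : measurable B.
  by rewrite -[B]setTI; exact: (measurable_row_cons measurableT).
have -> : [set p : mR * 'rV[R]_n | [set v | A (v + row_cons a w')]
    (row_cons p.1 p.2)] = [set p | B (p.1 + a, p.2 + w')].
  by apply/seteqP; split => p /=; rewrite row_consD.
rewrite /product_measure1.
transitivity (\int[@lebesgue_measure R]_x (vol (xsection B (x + a)%R)))%E.
  apply: eq_integral => x _ /=; rewrite -[RHS](ih w'); last first.
    exact: measurable_xsection.
  by [].
pose f : mR -> mR := fun s => s + a.
have mf : measurable_fun setT f by exact: measurable_funD.
rewrite -(@ge0_integral_pushforward _ _ _ _ R f mf _ setT
  (fun x => vol (xsection B x)))//; last first.
  exact: (measurable_fun_xsection (@vol R n) mB).
apply: eq_measure_integral => //= C mC _.
exact: lebesgue_measure_shift.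
Qed.

Lemma vol_box n (I : set mR) : measurable I ->
  vol [set v : 'rV[R]_n | forall i, I (v ord0 i)] =
  ((@lebesgue_measure R I) ^+ n)%E.
Proof.
move=> mI; elim: n => [|n ih].
  rewrite expe0 /vol/= /dirac indicE mem_set//= => -[].
  by [].
rewrite vol_row_cons expeS -ih.
rewrite (_ : [set p | _] = I `*` [set v : 'rV[R]_n | forall i, I (v ord0 i)]).
  rewrite product_measure1E//.
  apply: measurable_forall => i.
  by have := measurable_coord i measurableT mI; rewrite setTI.
by apply/seteqP; split => p /=; rewrite (row_consP _ _ (fun=> I)).
Qed.

End vol_translation.

(** * Volume under additive bijections *)

Section additive_maps.
Variables (R : realType) (n : nat).
Local Notation V := 'rV[R]_n.
Local Notation mR := (measurableTypeR R).

Lemma measurable_row_add d (S : measurableType d) (f g : S -> V) :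
  measurable_fun setT f -> measurable_fun setT g ->
  measurable_fun setT (fun x => f x + g x).
Proof.
move=> mf mg; apply: measurable_rowP => i.
rewrite (_ : (fun x => _) =
    (fun x => f x ord0 i : mR) \+ (fun x => g x ord0 i : mR)).
  apply: measurable_funD.
    exact: (measurableT_comp (measurable_coord i) mf).
  exact: (measurableT_comp (measurable_coord i) mg).
by apply/funext => v; rewrite mxE.
Qed.

Lemma measurable_row_scale (c : R) : measurable_fun setT (fun v : V => c *: v).
Proof.
apply: measurable_rowP => i.
rewrite (_ : (fun x => _) = (fun v : V => c * v ord0 i)).
  by apply: measurable_funM => //; exact: measurable_coord.
by apply/funext => v; rewrite mxE.
Qed.

Lemma measurable_row_opp d (S : measurableType d) (f : S -> V) :
  measurable_fun setT f -> measurable_fun setT (fun x => - f x).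
Proof.
move=> mf; rewrite (_ : (fun x => _) = (fun v : V => -1 *: v) \o f).
  by apply: measurableT_comp => //; exact: measurable_row_scale.
by apply/funext => x /=; rewrite scaleN1r.
Qed.

Lemma measurable_preim d (S : measurableType d) d' (S' : measurableType d')
  (f : S -> S') (A : set S') : measurable_fun setT f -> measurable A ->
  measurable [set x | A (f x)].
Proof. by move=> mf mA; have := mf measurableT _ mA; rewrite setTI. Qed.

(** Cavalieri principle; together with [eq_vol_ysection] it replaces explicit
    integrals in [vol_additive_preimage]. *)
Lemma eq_vol_xsection (S T : set (V * V)) :
  (forall x, vol [set y | S (x, y)] = vol [set y | T (x, y)]) ->
  (@vol R n \x @vol R n)%E S = (@vol R n \x @vol R n)%E T.
Proof.
move=> ST; apply: eq_integral => x _ /=.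
have E U : xsection U x = [set y : V | U (x, y)].
  by apply/seteqP; split => y /xsectionP.
by rewrite !E.
Qed.

Lemma eq_vol_ysection (S T : set (V * V)) : measurable S -> measurable T ->
  (forall y, vol [set x | S (x, y)] = vol [set x | T (x, y)]) ->
  (@vol R n \x @vol R n)%E S = (@vol R n \x @vol R n)%E T.
Proof.
move=> mS mT ST.
have E U : measurable U ->
    (@vol R n \x @vol R n)%E U = (@vol R n \x^ @vol R n)%E U.
  move=> mU; apply: product_measure_unique => // A B mA mB.
  exact: product_measure2E.
rewrite !E//; apply: eq_integral => y _ /=.
have E' U : ysection U y = [set x : V | U (x, y)].
  by apply/seteqP; split => x /ysectionP.
by rewrite !E'.
Qed.

(** Uniqueness of translation-invariant measures, in the form it is used. Both
    sides are product volumes; the pairs (x, y) with phi x in A and phi x + y in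
    D have the left-hand volume by sections in x. Translating each section in y
    by a preimage of y turns them into the pairs with phi x - y in A and phi x
    in D, which have the right-hand volume by sections in x again. With D of
    known volume, this computes the volume of a preimage. *)
Lemma vol_additive_preimage (phi : {additive V -> V}) (A D : set V) :
  measurable_fun setT phi -> (forall y, exists x, phi x = y) ->
  measurable A -> measurable D ->
  (vol (phi @^-1` A) * vol D = vol (phi @^-1` D) * vol [set v | A (- v)%R])%E.
Proof.
move=> mphi sphi mA mD.
have mNA : measurable [set v : V | A (- v)].
  by apply: measurable_preim mA; exact: measurable_row_opp.
have mA' : measurable (phi @^-1` A) by exact: measurable_preim.
have mD' : measurable (phi @^-1` D) by exact: measurable_preim.
have mphi1 : measurable_fun setT (fun p : V * V => phi p.1).
  exact: (measurableT_comp mphi).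
rewrite -!product_measure1E//.
pose S := [set p : V * V | A (phi p.1) /\ D (phi p.1 + p.2)].
pose T := [set p : V * V | A (phi p.1 - p.2) /\ D (phi p.1)].
have mS : measurable S.
  apply: measurableI; apply: measurable_preim => //.
  exact: measurable_row_add.
have mT : measurable T.
  apply: measurableI; apply: measurable_preim => //.
  by apply: measurable_row_add => //; exact: measurable_row_opp.
transitivity ((@vol R n \x @vol R n)%E S).
  apply: eq_vol_xsection => x; rewrite /S/=.
  have [Ax|nAx] := pselect (A (phi x)).
    transitivity (vol D); first by congr vol; apply/seteqP; split => y // -[].
    rewrite -(vol_shift (phi x) mD); congr vol; apply/seteqP.
    by split => y /=; rewrite addrC => // -[].
  by congr vol; apply/seteqP; split => y /= -[].
(* Translate each section in y by a preimage w of y. *)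
transitivity ((@vol R n \x @vol R n)%E T).
  apply: eq_vol_ysection => // y; have [w <-] := sphi y.
  rewrite -[RHS](vol_shift w); last first.
    apply: measurableI => //; apply: measurable_preim => //=.
    by apply: measurable_row_add.
  by congr vol; apply/seteqP; split => x /=; rewrite /S/T/= raddfD addrK.
apply: eq_vol_xsection => x; rewrite /T/=.
have [Dx|nDx] := pselect (D (phi x)).
  transitivity (vol [set v : V | A (- v)]); last first.
    by congr vol; apply/seteqP; split => y // -[].
  rewrite -(vol_shift (- phi x) mNA); congr vol; apply/seteqP.
  by split => y /=; rewrite opprB => // -[].
by congr vol; apply/seteqP; split => y /= -[].
Qed.

End additive_maps.

(** * Homotheties and orthogonal maps *)

Lemma mule_pmulIr (R : realType) (a x y : \bar R) : (0 < a)%E -> (a < +oo)%E ->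
  (x * a = y * a)%E -> x = y.
Proof.
move=> a0 aoo e; have fa : a \is a fin_num by rewrite gt0_fin_numE.
by apply/eqP; rewrite eq_le -(lee_pmul2r fa a0) -[(y <= x)%E](lee_pmul2r fa a0) e lexx.
Qed.

Section linear_images.
Variables (R : realType) (n : nat).
Local Notation V := 'rV[R]_n.
Local Notation mR := (measurableTypeR R).

Definition cube (c : R) : set V := [set v | forall i, `[- c, c]%classic (v ord0 i)].

Lemma measurable_cube c : measurable (cube c).
Proof.
apply: measurable_forall => i.
have := @measurable_coord R n i measurableT `[- c, c]%classic.
by rewrite setTI; apply; exact: measurable_itv.
Qed.

Lemma vol_cube c : 0 <= c -> vol (cube c) = ((c *+ 2) ^+ n)%:E.
Proof.
move=> c0; rewrite vol_box; last exact: measurable_itv.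
rewrite EFin_expe lebesgue_measure_itv/= lte_fin; case: ltP => h.
  by rewrite -EFinB opprK mulr2n.
have -> : c = 0 by apply/eqP; rewrite eq_le c0 andbT; lra.
by rewrite mul0rn.
Qed.

Lemma vol_cube_gt0 c : 0 < c -> (0 < vol (cube c))%E.
Proof. by move=> c0; rewrite vol_cube ?ltW// lte_fin exprn_gt0// mulrn_wgt0. Qed.

Lemma vol_cube_ltoo c : 0 <= c -> (vol (cube c) < +oo)%E.
Proof. by move=> c0; rewrite vol_cube// ltry. Qed.

(** The case where phi is the identity. *)
Lemma vol_opp (A : set V) : measurable A -> vol [set v | A (- v)] = vol A.
Proof.
move=> mA.
have := @vol_additive_preimage R n idfun A (cube 1) _ _ mA (measurable_cube 1).
move=> /(_ (@measurable_id _ _ _) (fun y => ex_intro _ y erefl)) /=.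
rewrite preimage_id preimage_id [RHS]muleC => e; apply/esym.
by apply: mule_pmulIr e; [exact: vol_cube_gt0|exact: vol_cube_ltoo].
Qed.

Lemma vol_scale (c : R) (A : set V) : 0 < c -> measurable A ->
  vol [set v | A (c *: v)] = ((c ^+ n)^-1%:E * vol A)%E.
Proof.
move=> c0 mA.
have /(_ (measurable_row_scale c)) := @vol_additive_preimage R n ( *:%R c) A (cube 1).
rewrite vol_opp// => /(_ _ mA (measurable_cube 1)) e.
apply: (@mule_pmulIr _ (vol (cube 1))).
- exact: vol_cube_gt0.
- exact: vol_cube_ltoo.
rewrite [LHS]e; last first.
  by move=> y; exists (c^-1 *: y); rewrite /= scalerA divff ?gt_eqF ?scale1r.
have -> : ( *:%R c) @^-1` cube 1 = cube c^-1.
  apply/seteqP; split => v h i; have := h i; rewrite /= !in_itv/= !mxE.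
    by rewrite -ler_norml normrM gtr0_norm// -ler_norml -ler_pdivlMl// mulr1.
  by rewrite -ler_norml => hv; rewrite -ler_norml normrM gtr0_norm// -ler_pdivlMl// mulr1.
rewrite !vol_cube ?invr_ge0 ?ltW// muleAC; congr (_ * _)%E.
by rewrite -EFinM; congr EFin; rewrite -exprVn -exprMn mulrnAr mulr1.
Qed.

Lemma measurable_dotp d (S : measurableType d) (f g : S -> V) :
  measurable_fun setT f -> measurable_fun setT g ->
  measurable_fun setT (fun x => dotp (f x) (g x) : mR).
Proof.
move=> mf mg; apply: measurable_sum => i.
apply: measurable_funM.
  exact: (measurableT_comp (measurable_coord i) mf).
exact: (measurableT_comp (measurable_coord i) mg).
Qed.

Lemma measurable_mulmx m (M : 'M[R]_(n, m)) :
  measurable_fun setT (fun v : V => v *m M).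
Proof.
apply: measurable_rowP => i.
rewrite (_ : (fun v => _) = (fun v : V => \sum_j v ord0 j * M j i : mR)).
  apply: measurable_sum => j.
  by apply: measurable_funM => //; exact: measurable_coord.
by apply/funext => v; rewrite mxE.
Qed.

Lemma dotpE (u v : V) : dotp u v = (u *m v^T) ord0 ord0.
Proof. by rewrite mxE; apply: eq_bigr => i _; rewrite mxE. Qed.

Lemma dotp_ge0 (u : V) : 0 <= dotp u u.
Proof. by apply: sumr_ge0 => i _; rewrite -expr2 sqr_ge0. Qed.

Lemma dotp_eq0 (u : V) : dotp u u = 0 -> u = 0.
Proof.
move/psumr_eq0P => h; apply/rowP => i; rewrite mxE; apply/eqP.
by rewrite -sqrf_eq0 expr2 h// => j _; rewrite -expr2 sqr_ge0.
Qed.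

End linear_images.

Section orthogonal.
Variables (R : realType) (n : nat).
Local Notation V := 'rV[R]_n.+1.

Let D : set V := [set v | dotp v v <= 1].

Let mD : measurable D.
Proof.
have mf : measurable_fun setT (fun v : V => dotp v v : measurableTypeR R).
  by apply: measurable_dotp; exact: measurable_id.
have := mf measurableT `]-oo, 1]%classic; rewrite setTI.
rewrite (_ : _ @^-1` _ = D); last by apply/seteqP; split => v /=; rewrite in_itv.
by apply; exact: measurable_itv.
Qed.

Let D_gt0 : (0 < vol D)%E.
Proof.
have c0 : 0 < n.+1%:R^-1 :> R by rewrite invr_gt0.
apply: (lt_le_trans (vol_cube_gt0 n.+1 c0)); apply: le_measure; rewrite ?inE//.
  exact: measurable_cube.
move=> v cv; rewrite /D/= /dotp.
(* The cube of half-side 1 / (n + 1) is contained in the ball. *)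
apply: (@le_trans _ _ (\sum_(i < n.+1) n.+1%:R^-1)); last first.
  by rewrite sumr_const card_ord -[X in X <= _]mulr_natl divff.
apply: ler_sum => i _; have := cv i; rewrite /= in_itv/= -ler_norml => h.
rewrite -expr2 -real_normK ?num_real//.
apply: (le_trans (_ : _ <= `|v ord0 i|)) => //.
rewrite expr2 ler_piMl//; apply: (le_trans h).
by rewrite invf_le1// ler1n.
Qed.

Let D_ltoo : (vol D < +oo)%E.
Proof.
apply: (le_lt_trans _ (vol_cube_ltoo n.+1 ler01)).
apply: le_measure; rewrite ?inE//; first exact: measurable_cube.
move=> v Dv i; rewrite /= in_itv/= -ler_norml -(@expr_le1 _ 2)// real_normK ?num_real//.
apply: le_trans Dv; rewrite /dotp (bigD1 i)//= expr2 lerDl.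
by apply: sumr_ge0 => j _; rewrite -expr2 sqr_ge0.
Qed.

(** The Euclidean ball D is its own preimage under O, so its volume cancels in
    [vol_additive_preimage]. *)
Lemma vol_orthogonal (O : 'M[R]_n.+1) (A : set V) : O *m O^T = 1%:M ->
  measurable A -> vol [set v | A (v *m O)] = vol A.
Proof.
move=> OO mA; have OO' : O^T *m O = 1%:M by apply: mulmx1C.
have /(_ (measurable_mulmx O)) := @vol_additive_preimage R n.+1 (mulmxr O) A D.
rewrite vol_opp// => /(_ _ mA mD) e.
apply: (mule_pmulIr D_gt0 D_ltoo); rewrite [LHS]e; last first.
  by move=> y; exists (y *m O^T); rewrite /= -mulmxA OO' mulmx1.
rewrite [RHS]muleC; congr (vol _ * _)%E.
apply/seteqP; split => v; rewrite /D/= /D/= !dotpE trmx_mul mulmxA -[v *m O *m _]mulmxA.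
  by rewrite OO mulmx1.
by rewrite OO mulmx1.
Qed.

End orthogonal.

(** * Borel sets and norms on row vectors *)

Section borel.
Variables (R : realType) (n : nat).
Local Notation V := 'rV[R]_n.
Local Notation mR := (measurableTypeR R).

Lemma coord_le_norm (v : V) i : `|v ord0 i| <= `|v|.
Proof.
rewrite [leRHS]/Num.norm /= mx_normrE.
by apply/bigmax_geP; right => /=; exists (ord0, i).
Qed.

Lemma norm_leP (v : V) (c : R) : 0 <= c ->
  (`|v| <= c) <-> (forall i, `|v ord0 i| <= c).
Proof.
move=> c0; split=> [vc i|h]; first exact: le_trans (coord_le_norm v i) vc.
rewrite [leLHS]/Num.norm /= mx_normrE; apply/bigmax_leP; split => // -[i j] _ /=.
by rewrite ord1.
Qed.

Lemma rat_dense_row (v : V) (e : R) : 0 < e ->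
  exists q : 'rV[rat]_n, `|v - map_mx ratr q| <= e.
Proof.
move=> e0.
have h i : exists q : rat, `|v ord0 i - ratr q| <= e.
  have /rat_in_itvoo[q] : v ord0 i - e < v ord0 i + e by lra.
  by rewrite in_itv/= => /andP[h1 h2]; exists q; rewrite ler_norml; lra.
have [f hf] := choice h; exists (\row_i f i); apply/norm_leP; first exact: ltW.
by move=> i; rewrite !mxE.
Qed.

(** An open set is the union of the rational cubes it contains. *)
Lemma open_row_measurable (A : set V) : open A -> measurable A.
Proof.
move=> oA.
pose near (q : 'rV[rat]_n) (k : nat) :=
  [set v : V | forall i, `|v ord0 i - ratr (q ord0 i)| <= k.+1%:R^-1].
have mnear q k : measurable (near q k).
  apply: measurable_forall => i.
  have := @measurable_coord R n i measurableT
    `[ratr (q ord0 i) - k.+1%:R^-1, ratr (q ord0 i) + k.+1%:R^-1]%classic.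
  rewrite setTI => /(_ (measurable_itv _)); congr (measurable _).
  by apply/seteqP; split => v /=; rewrite in_itv/= ler_distl.
rewrite (_ : A = [set v | exists qk : 'rV[rat]_n * nat,
    near qk.1 qk.2 v /\ near qk.1 qk.2 `<=` A]).
  apply: measurable_exists => -[q k] /=.
  have [qA|nqA] := pselect (near q k `<=` A).
    by rewrite (_ : [set v | _] = near q k)//; apply/seteqP; split => v // -[].
  by rewrite (_ : [set v | _] = set0)//; apply/seteqP; split => v // -[].
apply/seteqP; split => [v Av|v [[q k] [/= nv sA]]]; last exact: sA.
have /nbhs_ballP[e /= e0 eA] : nbhs v A by exact: open_nbhs_nbhs.
have [k ke] : exists k : nat, k.+1%:R^-1 < e / 2.
  by exists (Num.truncn (e / 2)^-1); rewrite invf_plt ?posrE ?divr_gt0//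
    Num.Theory.truncnS_gt.
have k0 : 0 < k.+1%:R^-1 :> R by rewrite invr_gt0.
have [q vq] := rat_dense_row v k0.
exists (q, k); split => /=.
  move=> i; have := coord_le_norm (v - map_mx ratr q) i; rewrite !mxE.
  by move=> /le_trans; apply.
move=> w nw; apply: eA; rewrite -ball_normE /ball_/=.
have wq : `|map_mx ratr q - w| <= k.+1%:R^-1.
  apply/norm_leP; first exact: ltW.
  by move=> i; rewrite !mxE distrC; exact: nw.
have := ler_normD (v - map_mx ratr q) (map_mx ratr q - w); rewrite subrKA.
by move=> /le_lt_trans; apply; rewrite (splitr e) ltrD// (le_lt_trans _ ke).
Qed.

Lemma closed_row_measurable (A : set V) : closed A -> measurable A.
Proof.
move=> cA; rewrite -[A]setCK; apply: measurableC; apply: open_row_measurable.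
exact: closed_openC.
Qed.

Lemma continuous_row_measurable (f : V -> R) : continuous f ->
  measurable_fun setT (f : V -> mR).
Proof.
move=> /continuousP cf; apply: (measurability _ (RGenOpens.measurableE R)).
move=> _ [_ [a [b ->] <-]]; rewrite setTI; apply: open_row_measurable.
exact/cf/interval_open.
Qed.

End borel.

Section norms.
Variables (R : realType) (n : nat) (N : 'rV[R]_n -> R).
Hypothesis hN : is_norm N.
Local Notation V := 'rV[R]_n.
Local Notation mR := (measurableTypeR R).

Lemma is_normZ a x : N (a *: x) = `|a| * N x. Proof. by case: hN. Qed.

Lemma is_normD x y : N (x + y) <= N x + N y. Proof. by case: hN. Qed.

Lemma is_norm_eq0 x : N x = 0 -> x = 0. Proof. by case: hN => _ _; apply. Qed.

Lemma is_norm0 : N 0 = 0.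
Proof. by rewrite -(scale0r (0 : V)) is_normZ normr0 mul0r. Qed.

Lemma is_normN x : N (- x) = N x.
Proof. by rewrite -scaleN1r is_normZ normrN1 mul1r. Qed.

Lemma is_norm_ge0 x : 0 <= N x.
Proof. by have := is_normD x (- x); rewrite subrr is_norm0 is_normN; lra. Qed.

Lemma is_norm_gt0 x : x != 0 -> 0 < N x.
Proof.
by move=> x0; rewrite lt_def is_norm_ge0 andbT; apply: contra_neq x0; exact: is_norm_eq0.
Qed.

Lemma is_normBC x y : N (x - y) = N (y - x).
Proof. by rewrite -is_normN opprB. Qed.

Lemma is_norm_triangle x y z : N (x - z) <= N (x - y) + N (y - z).
Proof. by rewrite -(subrKA y); exact: is_normD. Qed.

Lemma is_norm_le_sup : exists2 C : R, 0 < C & forall x, N x <= C * `|x|.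
Proof.
pose d i : V := delta_mx ord0 i.
exists (1 + \sum_i N (d i)).
  by rewrite ltr_pwDl// sumr_ge0// => i _; exact: is_norm_ge0.
move=> x; rewrite {1}[x]row_sum_delta.
apply: (@le_trans _ _ (\sum_i `|x| * N (d i))); last first.
  by rewrite -mulr_sumr mulrC ler_wpM2r// lerDr.
elim/big_ind2 : _ => [|a b a' b' h h'|i _].
- by rewrite is_norm0.
- by apply: (le_trans (is_normD _ _)); exact: lerD.
- by rewrite is_normZ ler_wpM2r ?is_norm_ge0// coord_le_norm.
Qed.

Lemma is_norm_continuous : continuous N.
Proof.
have [C C0 NC] := is_norm_le_sup.
move=> x; apply/(@cvgrPdist_le _ _ _ (nbhs x) (nbhs_filter x)) => e e0; apply/nbhs_ballP.
have d0 : 0 < C^-1 * e by rewrite mulr_gt0// invr_gt0.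
exists (C^-1 * e) => //= y; rewrite -ball_normE /ball_/= => xy.
apply: (@le_trans _ _ (N (x - y))).
  rewrite ler_norml; apply/andP; split.
    by have := is_normD (y - x) x; rewrite subrK is_normBC; lra.
  by have := is_normD (x - y) y; rewrite subrK; lra.
by apply: (le_trans (NC _)); rewrite -ler_pdivlMl//; exact: ltW.
Qed.

Lemma measurable_is_norm : measurable_fun setT (N : V -> mR).
Proof. by apply: continuous_row_measurable; exact: is_norm_continuous. Qed.

(** All norms are equivalent: N attains a positive minimum on the unit sphere of
    the sup norm. *)
Lemma is_norm_ge_sup : exists2 c : R, 0 < c & forall x, c * `|x| <= N x.
Proof.
pose S : set V := [set x | `|x| = 1].
have [S0|/set0P S0] := eqVneq S set0.
  exists 1 => // x; have [->|x0] := eqVneq x 0; first by rewrite normr0 mulr0 is_norm0.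
  have : S (`|x|^-1 *: x).
    by rewrite /S/= normrZ normfV normr_id mulVf// normr_eq0.
  by rewrite S0.
have cS : compact S.
  apply: bounded_closed_compact.
    by exists 1; split => // M M1 x /= ->; exact: ltW.
  apply: (@preimage_closed _ _ (fun x : V => `|x|) [set 1]).
    by move=> x _; exact: norm_continuous.
  exact: closed_eq.
have [c Sc hc] := @compact_EVT_min _ _ N _ S0 cS
  (continuous_subspaceT is_norm_continuous).
have c0 : c != 0.
  apply/eqP => c00; move: Sc; rewrite inE /S/= c00 normr0 => /eqP.
  by rewrite eq_sym oner_eq0.
exists (N c); first exact: is_norm_gt0.
move=> x; have [->|x0] := eqVneq x 0; first by rewrite normr0 mulr0 is_norm0.
have /hc : `|x|^-1 *: x \in S.
  by rewrite inE /S/= normrZ normfV normr_id mulVf// normr_eq0.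
by rewrite is_normZ normfV normr_id ler_pdivlMl ?normr_gt0// mulrC.
Qed.

End norms.

(** * Orthonormal coordinates adapted to a direction *)

Section frame.
Variables (R : realType) (n : nat).
Local Notation V := 'rV[R]_n.+1.
Implicit Types x v : V.

Lemma dotpC x v : dotp x v = dotp v x.
Proof. by apply: eq_bigr => i _; rewrite mulrC. Qed.

Lemma dotpDl x v w : dotp (x + v) w = dotp x w + dotp v w.
Proof. by rewrite !dotpE mulmxDl mxE. Qed.

Lemma dotpBl x v w : dotp (x - v) w = dotp x w - dotp v w.
Proof. by rewrite !dotpE mulmxBl !mxE. Qed.

Lemma dotpZl c x v : dotp (c *: x) v = c * dotp x v.
Proof. by rewrite !dotpE -scalemxAl mxE. Qed.

Lemma dotp_gt0 x : x != 0 -> 0 < dotp x x.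
Proof.
move=> x0; rewrite lt_def dotp_ge0 andbT.
by apply: contra_neq x0; exact: dotp_eq0.
Qed.

Lemma l2norm_gt0 x : x != 0 -> 0 < l2norm x.
Proof. by move=> x0; rewrite sqrtr_gt0 dotp_gt0. Qed.

Lemma l2norm_sqr x : l2norm x ^+ 2 = dotp x x.
Proof. by rewrite sqr_sqrtr// dotp_ge0. Qed.

Lemma mx11E (A B : 'M[R]_1) : A ord0 ord0 = B ord0 ord0 -> A = B.
Proof. by move=> AB; apply/matrixP => i j; rewrite !ord1. Qed.

Definition unit_dir x := (l2norm x)^-1 *: x.

Lemma unit_dirE x : x != 0 -> x = l2norm x *: unit_dir x.
Proof. by move=> x0; rewrite scalerA divff ?scale1r// gt_eqF// l2norm_gt0. Qed.

Lemma dotp_unit_dir x : x != 0 -> dotp (unit_dir x) (unit_dir x) = 1.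
Proof.
move=> x0; rewrite dotpZl dotpC dotpZl -l2norm_sqr.
by field; rewrite gt_eqF// l2norm_gt0.
Qed.

(** The Householder reflection that exchanges the first basis vector and e. *)
Lemma exists_orthogonal_row0 (e : V) : dotp e e = 1 ->
  exists H : 'M[R]_n.+1, H *m H^T = 1%:M /\ row ord0 H = e.
Proof.
move=> e1; pose e0 : V := delta_mx ord0 ord0.
have e01 : dotp e0 e0 = 1.
  by rewrite dotpE trmx_delta mul_delta_mx mxE !eqxx.
have rowE (H : 'M[R]_n.+1) : row ord0 H = e0 *m H by rewrite rowE.
have [->|ne] := eqVneq e e0.
  by exists 1%:M; rewrite trmx1 mulmx1 rowE mulmx1.
pose v : V := e0 - e; pose c := 2 / dotp v v.
have v0 : 0 < dotp v v by apply: dotp_gt0; rewrite subr_eq0 eq_sym.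
have vv : dotp v v = 2 * dotp e0 v.
  rewrite /v !dotpBl [dotp e0 (_ - _)]dotpC [dotp e (_ - _)]dotpC !dotpBl.
  by rewrite e1 e01 (dotpC e e0); ring.
have vvT : v *m v^T = (dotp v v)%:M.
  by apply: mx11E; rewrite -dotpE mxE eqxx mulr1n.
have [P PP [PT e0P]] : exists2 P : 'M[R]_n.+1, P *m P = dotp v v *: P &
    P^T = P /\ e0 *m P = dotp e0 v *: v.
  exists (v^T *m v); last split.
  - by rewrite -mulmxA [v *m (_ *m _)]mulmxA vvT mul_scalar_mx -scalemxAr.
  - by rewrite trmx_mul trmxK.
  - rewrite mulmxA -mul_scalar_mx; congr (_ *m _).
    by apply: mx11E; rewrite -dotpE mxE eqxx mulr1n.
exists (1%:M - c *: P); split.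
  have -> : (1%:M - c *: P)^T = 1%:M - c *: P.
    by rewrite [LHS]linearB/= trmx1 [(c *: P)^T]linearZ/= PT.
  rewrite mulmxBl mul1mx mulmxBr mulmx1.
  rewrite -scalemxAl -scalemxAr PP !scalerA.
  have -> : c * c * dotp v v = c + c by rewrite /c; field; rewrite gt_eqF.
  by rewrite scalerDl opprB addrK subrK.
rewrite rowE mulmxBr mulmx1 -scalemxAr e0P scalerA.
have -> : c * dotp e0 v = 1.
  rewrite /c vv; field; move: v0; rewrite vv.
  by apply: contraTneq => ->; rewrite mulr0 ltxx.
by rewrite scale1r /v opprB addrC subrK.
Qed.

Lemma perp_frameP x : x != 0 ->
  perp_frame x *m (perp_frame x)^T = 1%:M /\ perp_frame x *m x^T = 0.
Proof.
move=> x0; have [H [HH He]] := exists_orthogonal_row0 (dotp_unit_dir x0).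
rewrite /perp_frame.
apply: (@xgetPex _ 0 [set U : 'M[R]_(n, n.+1) | U *m U^T = 1%:M /\ U *m x^T = 0]).
have E i j : \sum_k H i k * H j k = (i == j)%:R.
  have /matrixP/(_ i j) := HH; rewrite !mxE => <-.
  by apply: eq_bigr => k _; rewrite mxE.
exists (row' ord0 H); split; apply/matrixP => i j; rewrite !mxE.
  under eq_bigr do rewrite !mxE.
  by rewrite E (inj_eq lift_inj).
under eq_bigr do rewrite !mxE.
rewrite {1}(unit_dirE x0) -He.
under eq_bigr do rewrite !mxE mulrCA.
by rewrite -mulr_sumr E eq_sym (negbTE (neq_lift _ _)) mulr0.
Qed.

Definition frame_mx x : 'M[R]_n.+1 :=
  col_mx (unit_dir x) (perp_frame x) : 'M[R]_(1 + n, n.+1).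

Lemma frame_mx_orthogonal x : x != 0 -> frame_mx x *m (frame_mx x)^T = 1%:M.
Proof.
move=> x0; have [UU Ux] := perp_frameP x0.
have Ue : perp_frame x *m (unit_dir x)^T = 0.
  by rewrite /unit_dir linearZ/= -scalemxAr Ux scaler0.
have eU : unit_dir x *m (perp_frame x)^T = 0.
  by rewrite -[LHS]trmxK trmx_mul trmxK Ue trmx0.
have ee : unit_dir x *m (unit_dir x)^T = 1%:M.
  by apply: mx11E; rewrite -dotpE dotp_unit_dir// mxE eqxx.
have h : col_mx (unit_dir x) (perp_frame x) *m
    (col_mx (unit_dir x) (perp_frame x))^T = 1%:M :> 'M[R]_(1 + n).
  by rewrite tr_col_mx mul_col_row UU Ue eU ee -scalar_mx_block.
exact: h.
Qed.

(** The point with coordinates (s, t) in the frame made of x / |x| and the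
    hyperplane frame: s runs along x, t in the hyperplane. *)
Definition along x (s : R) (t : 'rV[R]_n) : V := s *: unit_dir x + t *m perp_frame x.

Lemma row_cons_frame x s t : row_cons s t *m frame_mx x = along x s t.
Proof.
have h : row_mx (const_mx s : 'rV[R]_1) t *m
    (col_mx (unit_dir x) (perp_frame x)) = along x s t.
  rewrite mul_row_col /along; congr (_ + _).
  rewrite -mul_scalar_mx; congr (_ *m _).
  by apply: mx11E; rewrite !mxE eqxx mulr1n.
exact: h.
Qed.

Lemma along_surj x v : x != 0 -> exists s, v = along x s (v *m (perp_frame x)^T).
Proof.
move=> x0; exists ((v *m (unit_dir x)^T) ord0 ord0).
have OO := mulmx1C (frame_mx_orthogonal x0).
have h : v *m ((col_mx (unit_dir x) (perp_frame x))^T *m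
    col_mx (unit_dir x) (perp_frame x)) = v.
  by rewrite [X in v *m X]OO mulmx1.
rewrite -{1}h tr_col_mx mul_row_col mulmxDr /along !mulmxA; congr (_ + _).
rewrite -mul_scalar_mx; congr (_ *m _).
by apply: mx11E; rewrite !mxE eqxx mulr1n.
Qed.

Lemma along_perp x s t : x != 0 -> along x s t *m (perp_frame x)^T = t.
Proof.
move=> x0; have [UU Ux] := perp_frameP x0.
rewrite mulmxDl -mulmxA UU mulmx1 -scalemxAl -[_ *m _]trmxK trmx_mul trmxK.
by rewrite linearZ/= -scalemxAr Ux scaler0 trmx0 scaler0 add0r.
Qed.

Lemma orth_proj_along x s t : x != 0 -> orth_proj x (along x s t) = t *m perp_frame x.
Proof.
move=> x0; have [UU Ux] := perp_frameP x0.
rewrite /orth_proj.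
have -> : dotp (along x s t) x = s * l2norm x.
  rewrite dotpDl dotpZl dotpZl -l2norm_sqr [X in _ + X]dotpE -mulmxA Ux mulmx0 mxE.
  by field; rewrite gt_eqF// l2norm_gt0.
rewrite -l2norm_sqr [X in _ *: X](unit_dirE x0) scalerA.
have -> : s * l2norm x / l2norm x ^+ 2 * l2norm x = s.
  by field; rewrite gt_eqF// l2norm_gt0.
by rewrite /along addrAC subrr add0r.
Qed.

Lemma perp_frame_inj x : x != 0 -> injective (fun t : 'rV[R]_n => t *m perp_frame x).
Proof.
move=> x0 s t /= st; have [UU Ux] := perp_frameP x0.
by rewrite -[s]mulmx1 -[t]mulmx1 -UU !mulmxA st.
Qed.

Lemma alongD x s t s' t' : along x s t + along x s' t' = along x (s + s') (t + t').
Proof. by rewrite /along scalerDl mulmxDl addrACA. Qed.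

Lemma alongZ c x s t : c *: along x s t = along x (c * s) (c *: t).
Proof. by rewrite /along scalerDr scalerA scalemxAl. Qed.

Lemma along_dir x s : along x s 0 = s *: unit_dir x.
Proof. by rewrite /along mul0mx addr0. Qed.

Lemma measurable_along x :
  measurable_fun setT (fun p : measurableTypeR R * 'rV[R]_n => along x p.1 p.2).
Proof.
rewrite (_ : (fun p => _) = (fun v : V => v *m frame_mx x) \o
  (fun p : measurableTypeR R * 'rV[R]_n => row_cons p.1 p.2)).
  by apply: measurableT_comp; [exact: measurable_mulmx|exact: measurable_row_cons].
by apply/funext => p /=; rewrite row_cons_frame.
Qed.

(** Rotation invariance followed by Fubini: volume is the integral over the
    hyperplane of the lengths of the sections parallel to x. *)
Lemma vol_along x (A : set V) : x != 0 -> measurable A ->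
  vol A = (\int[@vol R n]_t @lebesgue_measure R [set s | A (along x s t)])%E.
Proof.
move=> x0 mA; rewrite -(vol_orthogonal (frame_mx_orthogonal x0) mA) vol_row_cons.
set G := [set p | _].
have mG : measurable G.
  have := measurable_preim (@measurable_along x) mA.
  by congr measurable; apply/seteqP; split => p; rewrite /G/= row_cons_frame.
rewrite (@product_measure_unique _ _ _ _ _ (@lebesgue_measure R) (@vol R n)
  (@lebesgue_measure R \x^ @vol R n)%E)//; last first.
  by move=> A' B' mA' mB'; exact: product_measure2E.
apply: eq_integral => t _ /=; congr (lebesgue_measure _).
apply/seteqP; split => s.
  by move/ysectionP; rewrite /G/= row_cons_frame.
by move=> h; apply/ysectionP; rewrite /G/= row_cons_frame.
Qed.

End frame.

(** * Two one-variable estimates *)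

Section shift_difference.
Variable R : realType.
Local Notation mu := (@lebesgue_measure R).
Variables (S : set R) (l K : R).
Hypothesis mS : measurable (S : set (measurableTypeR R)).
Hypothesis convS : forall a b s, S a -> S b -> a <= s <= b -> S s.
Hypothesis bdS : forall s, S s -> s <= K.
Hypothesis l0 : 0 < l.

Let D := [set s | S (s - l) /\ ~ S s].

Let mD : measurable (D : set (measurableTypeR R)).
Proof.
apply: measurableI; last exact: measurableC.
apply: (@measurable_preim _ (measurableTypeR R) _ (measurableTypeR R)
  (fun s => s - l) S) => //.
by apply: measurable_funB.
Qed.

Let sup_ub s : S s -> s <= sup S.
Proof.
move=> Ss; apply: ub_le_sup => //.
by exists K => t /bdS.
Qed.

(** A point of S + l outside S lies above all of S, hence between sup S and sup
    S + l. *)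
Lemma shift_diff_le : (mu D <= l%:E)%E.
Proof.
apply: (@le_trans _ _ (mu `[sup S, sup S + l]%classic)).
  apply: le_measure; rewrite ?inE; [exact: mD|exact: measurable_itv|].
  move=> s [Ssl nSs]; rewrite /= in_itv/= -lerBlDr sup_ub// andbT.
  apply: sup_le_ub; first by exists (s - l).
  move=> t St; rewrite leNgt; apply/negP => st; apply: nSs.
  by apply: (convS Ssl St); rewrite gerBl !ltW.
rewrite lebesgue_measure_itv/= lte_fin ltrDl l0 -EFinB.
by rewrite addrAC subrr add0r.
Qed.

(** If S is at least as long as the shift, everything strictly between sup S and
    sup S + l is in S + l. *)
Lemma shift_diff_ge a b : S a -> S b -> l <= b - a -> (l%:E <= mu D)%E.
Proof.
move=> Sa Sb lab.
apply: (@le_trans _ _ (mu `]sup S, sup S + l[%classic)); last first.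
  apply: le_measure; rewrite ?inE; [exact: measurable_itv|exact: mD|].
  move=> s; rewrite /= in_itv/= => /andP[h1 h2]; split; last first.
    by move=> /sup_ub; rewrite leNgt h1.
  have [||t St st] := @sup_gt R S (s - l).
  - by exists a.
  - by rewrite ltrBlDr.
  by apply: (convS Sa St); rewrite (ltW st) andbT; have := sup_ub Sb; lra.
rewrite lebesgue_measure_itv/= lte_fin ltrDl l0 -EFinB.
by rewrite addrAC subrr add0r.
Qed.

End shift_difference.

Section pow_limit.
Variable R : realType.

Lemma bernoulli_le (d : R) m : 0 <= d <= 1 -> 1 - m%:R * d <= (1 - d) ^+ m.
Proof.
move=> /andP[d0 d1]; elim: m => [|m ih]; first by rewrite expr0 mul0r subr0.
rewrite exprS; apply: (@le_trans _ _ ((1 - d) * (1 - m%:R * d))).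
  rewrite -subr_ge0 -natr1.
  have -> : (1 - d) * (1 - m%:R * d) - (1 - (m%:R + 1) * d) = m%:R * d * d by ring.
  by rewrite !mulr_ge0.
by rewrite ler_wpM2l// subr_ge0.
Qed.

(** Lets a factor (1 - d)^m tend to 1; the slack is quantified by Bernoulli's
    inequality. *)
Lemma le_of_pow_limit (a b : R) m : 0 <= a ->
  (forall d, 0 < d < 1 -> a * (1 - d) ^+ m <= b) -> a <= b.
Proof.
move=> a0 h; rewrite leNgt; apply/negP => ba.
have b0 : 0 <= b.
  apply: le_trans (h 2^-1 _); last by rewrite invr_gt0 ltr0n invf_lt1 ?ltr1n.
  rewrite mulr_ge0// exprn_ge0//; lra.
have a1 : 0 < a by apply: le_lt_trans ba.
(* Chosen so that a (1 - m d) > b; the summand 2 in m + 2 makes d < 1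
   even when m = 0. *)
pose d := (a - b) / (m.+2%:R * a).
have m0 : 0 < m.+2%:R :> R by rewrite ltr0n.
have m1 : 1 < m.+2%:R :> R by rewrite ltr1n.
have d0 : 0 < d by rewrite divr_gt0 ?mulr_gt0 ?subr_gt0.
have d1 : d < 1.
  rewrite ltr_pdivrMr ?mulr_gt0// mul1r.
  apply: (@le_lt_trans _ _ a); first by lra.
  by rewrite ltr_pMl.
have := h d; rewrite d0 d1 => /(_ isT).
have := @bernoulli_le d m; rewrite (ltW d0) (ltW d1) => /(_ isT) hb hd.
have : a * (1 - m%:R * d) <= b by apply: le_trans hd; rewrite ler_pM2l.
have -> : a * (1 - m%:R * d) = a - (a - b) * (m%:R / m.+2%:R).
  by rewrite /d; field; rewrite !gt_eqF.
rewrite leNgt => /negP; apply.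
have q1 : 0 < 1 - m%:R / m.+2%:R :> R.
  by rewrite subr_gt0 ltr_pdivrMr// mul1r ltr_nat.
rewrite -subr_gt0.
have -> : a - (a - b) * (m%:R / m.+2%:R) - b = (a - b) * (1 - m%:R / m.+2%:R) by ring.
by rewrite mulr_gt0// subr_gt0.
Qed.

End pow_limit.

(** * Slicing a set along a direction *)

Section along_sections.
Variables (R : realType) (n : nat).
Local Notation V := 'rV[R]_n.+1.
Local Notation mu := (@lebesgue_measure R).

Lemma measurable_along_set (x : V) (A : set V) : measurable A ->
  measurable [set p : measurableTypeR R * 'rV[R]_n | A (along x p.1 p.2)].
Proof. by move=> mA; exact: (measurable_preim (@measurable_along R n x) mA). Qed.

Lemma along_ysection (x : V) (A : set V) t :
  ysection [set p : measurableTypeR R * 'rV[R]_n | A (along x p.1 p.2)] t =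
  [set s | A (along x s t)].
Proof. by apply/seteqP; split => s => [/ysectionP//|h]; exact/ysectionP. Qed.

Lemma measurable_along_section (x : V) (A : set V) t : measurable A ->
  measurable ([set s | A (along x s t)] : set (measurableTypeR R)).
Proof.
move=> mA; rewrite -along_ysection.
by apply: measurable_ysection; exact: measurable_along_set.
Qed.

Lemma measurable_fun_along_section (x : V) (A : set V) : measurable A ->
  measurable_fun setT (fun t => mu [set s | A (along x s t)]).
Proof.
move=> mA; have := measurable_fun_ysection mu (measurable_along_set x mA).
by apply: eq_measurable_fun => t _ /=; rewrite along_ysection.
Qed.

Lemma integral_cst_indic (c : R) (P : set 'rV[R]_n) : 0 <= c -> measurable P ->
  (\int[@vol R n]_t (c%:E * (\1_P t)%:E) = c%:E * vol P)%E.
Proof.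
move=> c0 mP; rewrite ge0_integralZl//; last first.
  by apply/measurable_EFinP; exact: measurable_indic.
by rewrite integral_indic// setIT.
Qed.

Lemma vol_along_le (x : V) (A : set V) (c : R) (P : set 'rV[R]_n) : x != 0 ->
  0 <= c -> measurable A -> measurable P ->
  (forall t, ~ P t -> forall s, ~ A (along x s t)) ->
  (forall t, (mu [set s | A (along x s t)] <= c%:E)%E) ->
  (vol A <= c%:E * vol P)%E.
Proof.
move=> x0 c0 mA mP AP Ac; rewrite (vol_along x0 mA) -integral_cst_indic//.
apply: ge0_le_integral => //.
- exact: measurable_fun_along_section.
- by apply: measurable_funeM; apply/measurable_EFinP; exact: measurable_indic.
- move=> t _; rewrite indicE; case: (boolP (t \in P)) => [_|]; first by rewrite mule1.
  rewrite notin_setE => nPt; rewrite mule0 (_ : [set s | _] = set0) ?measure0//.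
  by apply/seteqP; split => s //= /(AP t nPt).
Qed.

Lemma vol_along_ge (x : V) (A : set V) (c : R) (P : set 'rV[R]_n) : x != 0 ->
  0 <= c -> measurable A -> measurable P ->
  (forall t, P t -> (c%:E <= mu [set s | A (along x s t)])%E) ->
  (c%:E * vol P <= vol A)%E.
Proof.
move=> x0 c0 mA mP Ac; rewrite (vol_along x0 mA) -integral_cst_indic//.
apply: ge0_le_integral => //.
- by move=> t _; rewrite mule_ge0// lee_fin.
- by apply: measurable_funeM; apply/measurable_EFinP; exact: measurable_indic.
- exact: measurable_fun_along_section.
- move=> t _; rewrite indicE; case: (boolP (t \in P)) => [|_]; last by rewrite mule0.
  by rewrite inE mule1 => /Ac.
Qed.

End along_sections.

(** * Balls and shadows of the unit ball *)

Section norm_geometry.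
Variables (R : realType) (n : nat) (N : 'rV[R]_n -> R).
Hypothesis hN : is_norm N.
Local Notation V := 'rV[R]_n.

Definition open_ball (c : V) (r : R) : set V := [set v | N (v - c) < r].

Lemma measurable_open_ball c r : measurable (open_ball c r).
Proof.
have mf : measurable_fun setT (fun v : V => N (v - c) : measurableTypeR R).
  by apply: (measurableT_comp (measurable_is_norm hN)); exact: measurable_row_shift.
have := mf measurableT `]-oo, r[%classic (measurable_itv _).
rewrite setTI; congr measurable; apply/seteqP; by split => v /=; rewrite in_itv.
Qed.

Lemma measurable_unit_ball : measurable (unit_ball N).
Proof.
have := measurable_is_norm hN measurableT (measurable_itv `]-oo, 1]).
rewrite setTI; congr measurable; apply/seteqP; by split => v /=; rewrite in_itv.
Qed.

Lemma vol_bounded_ltoo (A : set V) (K : R) : measurable A ->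
  (forall v, A v -> N v <= K) -> (vol A < +oo)%E.
Proof.
move=> mA AK; have [c c0 cN] := is_norm_ge_sup hN.
have K0 : 0 <= `|K| / c by rewrite divr_ge0// ltW.
apply: (le_lt_trans _ (vol_cube_ltoo n K0)); apply: le_measure; rewrite ?inE//.
  exact: measurable_cube.
move=> v Av i; rewrite /= in_itv/= -ler_norml (le_trans (coord_le_norm v i))//.
rewrite ler_pdivlMr// mulrC (le_trans (cN v))// (le_trans (AK v Av))//.
exact: ler_norm.
Qed.

Lemma cube_sub_ball r : 0 < r -> exists2 c : R, 0 < c & cube c `<=` [set v : V | N v < r].
Proof.
move=> r0; have [C C0 NC] := is_norm_le_sup hN.
have c0 : 0 < r / 2 / C by rewrite !divr_gt0.
exists (r / 2 / C) => // v cv /=; apply: (le_lt_trans (NC v)).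
have : `|v| <= r / 2 / C.
  apply/norm_leP; first exact: ltW.
  by move=> i; rewrite ler_norml; have := cv i; rewrite /= in_itv.
rewrite ler_pdivlMr// mulrC => /le_lt_trans; apply.
by rewrite ltr_pdivrMr// ltr_pMr// ltr1n.
Qed.

Lemma vol_open_ball_gt0 r : 0 < r -> (0 < vol (open_ball 0 r))%E.
Proof.
move=> r0; have [c c0 cN] := cube_sub_ball r0.
apply: (lt_le_trans (vol_cube_gt0 n c0)); apply: le_measure; rewrite ?inE//.
- exact: measurable_cube.
- exact: measurable_open_ball.
- by move=> v /cN; rewrite /open_ball/= subr0.
Qed.

Lemma vol_open_ball_ltoo r : (vol (open_ball 0 r) < +oo)%E.
Proof.
apply: (@vol_bounded_ltoo _ r); first exact: measurable_open_ball.
by move=> v; rewrite /open_ball/= subr0 => /ltW.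
Qed.

(** A ball and its interior have the same volume because (1 - d) B lies in the
    open ball for every d > 0. *)
Lemma vol_unit_ball : vol (unit_ball N) = vol (open_ball 0 1).
Proof.
have fB : vol (unit_ball N) \is a fin_num.
  rewrite ge0_fin_numE//; apply: (@vol_bounded_ltoo _ 1) => //.
  exact: measurable_unit_ball.
have fO : vol (open_ball 0 1) \is a fin_num.
  by rewrite ge0_fin_numE//; exact: vol_open_ball_ltoo.
apply/eqP; rewrite eq_le; apply/andP; split; last first.
  apply: le_measure; rewrite ?inE; [exact: measurable_open_ball|
    exact: measurable_unit_ball|].
  by move=> v; rewrite /open_ball/= subr0 => /ltW.
rewrite -(fineK fB) -(fineK fO) lee_fin.
apply: (@le_of_pow_limit _ _ _ n); first exact: fine_ge0.
move=> d /andP[d0 d1]; rewrite -lee_fin EFinM !fineK//.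
have c0 : 0 < (1 - d)^-1 by rewrite invr_gt0 subr_gt0.
have := vol_scale c0 measurable_unit_ball.
rewrite -exprVn invrK muleC => <-.
apply: le_measure; rewrite ?inE; last 2 first.
- exact: measurable_open_ball.
- move=> v; rewrite /unit_ball /open_ball/= subr0 (is_normZ hN) gtr0_norm//.
  by rewrite ler_pdivrMl ?subr_gt0// mulr1 => /le_lt_trans; apply; lra.
- exact: measurable_preim (measurable_row_scale _) measurable_unit_ball.
Qed.

End norm_geometry.

Section shadow.
Variables (R : realType) (n : nat) (N : 'rV[R]_n.+1 -> R).
Hypothesis hN : is_norm N.
Local Notation V := 'rV[R]_n.+1.
Local Notation mu := (@lebesgue_measure R).

(** The projection of the unit ball in the coordinates of [perp_frame x]; its
    volume is the hyperplane volume in [polar_projection_norm]. *)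
Definition shadow (x : V) : set 'rV[R]_n :=
  [set t | (orth_proj x @` unit_ball N) (t *m perp_frame x)].

Lemma shadowP x t : x != 0 -> shadow x t <-> exists s, N (along x s t) <= 1.
Proof.
move=> x0; split=> [[v Bv]|[s Ns]]; last first.
  by exists (along x s t) => //; exact: orth_proj_along.
have [s vs] := along_surj v x0; rewrite vs orth_proj_along// => /(perp_frame_inj x0).
by move=> h; exists s; rewrite -h -vs.
Qed.

(** |v| + |v M| is a norm in v, so it is bounded by a multiple of |v|. *)
Lemma mulmx_bounded m k (M : 'M[R]_(m, k)) :
  exists2 C : R, 0 < C & forall v : 'rV[R]_m, `|v *m M| <= C * `|v|.
Proof.
pose rho (v : 'rV[R]_m) := `|v| + `|v *m M|.
have hrho : is_norm rho.
  split=> [x y|a x|x].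
  - by rewrite /rho mulmxDl addrACA lerD// ler_normD.
  - by rewrite /rho -scalemxAl !normrZ mulrDr.
  - move=> /eqP; rewrite /rho paddr_eq0// => /andP[/eqP/normr0_eq0 //].
have [C C0 rC] := is_norm_le_sup hrho.
by exists C => // v; apply: le_trans (rC v); rewrite lerDr.
Qed.

Lemma mulmx_continuous m k (M : 'M[R]_(m, k)) : continuous (fun v : 'rV[R]_m => v *m M).
Proof.
have [C C0 MC] := mulmx_bounded M.
move=> x; apply/(@cvgrPdist_le _ _ _ (nbhs x) (nbhs_filter x)) => e e0.
apply/nbhs_ballP.
have d0 : 0 < C^-1 * e by rewrite mulr_gt0// invr_gt0.
exists (C^-1 * e) => //= y; rewrite -ball_normE /ball_/= => xy.
rewrite -mulmxBl; apply: (le_trans (MC _)).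
by rewrite -ler_pdivlMl//; exact: ltW.
Qed.

Lemma compact_unit_ball : compact (unit_ball N).
Proof.
have [c c0 cN] := is_norm_ge_sup hN.
apply: bounded_closed_compact.
  exists c^-1; split=> [|M M1 x /= Bx]; first exact: num_real.
  apply/ltW/(le_lt_trans _ M1).
  by rewrite -[leRHS]mulr1 ler_pdivlMl//; exact: le_trans Bx.
apply: (@preimage_closed _ _ N [set r | r <= 1]).
  by move=> x _; exact: is_norm_continuous.
exact: closed_le.
Qed.

(** A shadow is compact, as a continuous image of the ball. *)
Lemma measurable_shadow x : x != 0 -> measurable (shadow x).
Proof.
move=> x0; apply: closed_row_measurable.
have -> : shadow x = (fun v => v *m (perp_frame x)^T) @` unit_ball N.
  apply/seteqP; split => t.
    by move=> /(shadowP _ x0)[s Ns]; exists (along x s t) => //; exact: along_perp.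
  move=> [v Bv <-]; apply/(shadowP _ x0).
  by have [s vs] := along_surj v x0; exists s; rewrite -vs.
apply: compact_closed; first exact: norm_hausdorff.
apply: continuous_compact; last exact: compact_unit_ball.
by apply: continuous_subspaceT; exact: mulmx_continuous.
Qed.

Lemma vol_shadow_ltoo x : x != 0 -> (vol (shadow x) < +oo)%E.
Proof.
move=> x0; have [c c0 cN] := is_norm_ge_sup hN.
have [C C0 MC] := mulmx_bounded (perp_frame x)^T.
have K0 : 0 <= C * c^-1 by rewrite ltW// divr_gt0.
apply: (le_lt_trans _ (vol_cube_ltoo n K0)).
apply: le_measure; rewrite ?inE; [exact: measurable_shadow|exact: measurable_cube|].
move=> t /(shadowP _ x0)[s Ns] i; rewrite /= in_itv/= -ler_norml.
rewrite (le_trans (coord_le_norm t i))// -(along_perp s t x0).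
rewrite (le_trans (MC _))// ler_pM2l// -[leRHS]mulr1 ler_pdivlMl//.
exact: le_trans Ns.
Qed.

Lemma vol_shadow_gt0 x : x != 0 -> (0 < vol (shadow x))%E.
Proof.
move=> x0; have [C C0 NC] := is_norm_le_sup hN.
have [D D0 MD] := mulmx_bounded (perp_frame x).
have c0 : 0 < D^-1 * C^-1 by rewrite mulr_gt0 ?invr_gt0.
apply: (lt_le_trans (vol_cube_gt0 n c0)).
apply: le_measure; rewrite ?inE; [exact: measurable_cube|exact: measurable_shadow|].
move=> t ct; apply/(shadowP _ x0); exists 0; rewrite /along scale0r add0r.
apply: (le_trans (NC _)); rewrite -ler_pdivlMl// mulr1.
apply: (le_trans (MD _)); rewrite -ler_pdivlMl//.
apply/norm_leP => [|i]; first exact: ltW.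
by rewrite ler_norml; have := ct i; rewrite /= in_itv.
Qed.

End shadow.

(** * Difference of two balls, and the polar projection norm *)

Section ball_difference.
Variables (R : realType) (n : nat) (N : 'rV[R]_n.+1 -> R).
Hypothesis hN : is_norm N.
Local Notation V := 'rV[R]_n.+1.
Local Notation mu := (@lebesgue_measure R).
Local Notation pN := (polar_projection_norm N).

Definition ball_diff (x y : V) (r : R) : set V := open_ball N x r `\` open_ball N y r.

Lemma measurable_ball_diff x y r : measurable (ball_diff x y r).
Proof. by apply: measurableD; exact: measurable_open_ball. Qed.

Lemma vol_ball_diff_shift x y r w :
  vol (ball_diff (x + w) (y + w) r) = vol (ball_diff x y r).
Proof.
rewrite -(vol_shift w (measurable_ball_diff (x + w) (y + w) r)); congr vol.
have E v u : v + w - (u + w) = v - u by rewrite opprD addrACA subrr addr0.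
by apply/seteqP; split => v; rewrite /ball_diff /open_ball/= !E.
Qed.

Lemma vol_ball_diff_scale x y r c : 0 < c ->
  (vol (ball_diff (c *: x) (c *: y) (c * r)) =
   (c ^+ n.+1)%:E * vol (ball_diff x y r))%E.
Proof.
move=> c0.
have <- : [set v | ball_diff (c *: x) (c *: y) (c * r) (c *: v)] = ball_diff x y r.
  by apply/seteqP; split => v; rewrite /ball_diff /open_ball/= -!scalerBr
    !(is_normZ hN) (gtr0_norm c0) !ltr_pM2l.
rewrite vol_scale//; last exact: measurable_ball_diff.
by rewrite muleA -EFinM divff ?mul1e// gt_eqF// exprn_gt0.
Qed.

Section fiber.
Variables (x : V) (tau : R).
Hypotheses (x0 : x != 0) (tau0 : 0 < tau).

Let l := tau * l2norm x.
Let l0 : 0 < l. Proof. by rewrite mulr_gt0// l2norm_gt0. Qed.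

Let S t := [set s | N (along x s t) < 1].

Let mS t : measurable (S t : set (measurableTypeR R)).
Proof.
have := measurable_along_section x t (measurable_open_ball hN 0 1).
by congr measurable; apply/seteqP; split => s; rewrite /open_ball/= subr0.
Qed.

Let e0 : 0 < N (unit_dir x).
Proof.
apply: is_norm_gt0 => //; rewrite scaler_eq0 (negbTE x0) orbF invr_eq0.
by rewrite gt_eqF// l2norm_gt0.
Qed.

Let convS t a b s : S t a -> S t b -> a <= s <= b -> S t s.
Proof.
rewrite /S/= => Sa Sb /andP[]; rewrite le_eqVlt => /predU1P[<- //|as_].
rewrite le_eqVlt => /predU1P[-> //|sb].
have ab : 0 < b - a by rewrite subr_gt0 (lt_trans as_).
pose th := (s - a) / (b - a).
have th0 : 0 < th by rewrite divr_gt0// subr_gt0.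
have th1 : th < 1 by rewrite ltr_pdivrMr// mul1r ltrD2r.
have -> : along x s t = (1 - th) *: along x a t + th *: along x b t.
  rewrite !alongZ alongD -scalerDl subrK scale1r; congr along.
  by rewrite /th; field; rewrite gt_eqF.
apply: (le_lt_trans (is_normD hN _ _)); rewrite !(is_normZ hN).
rewrite !gtr0_norm ?subr_gt0//.
have h1 : (1 - th) * N (along x a t) < 1 - th by rewrite gtr_pMr// subr_gt0.
have h2 : th * N (along x b t) < th by rewrite gtr_pMr.
by have := ltrD h1 h2; rewrite subrK.
Qed.

Let bdS t s : S t s -> s <= (1 + N (along x 0 t)) / N (unit_dir x).
Proof.
rewrite /S/= => Ss; rewrite ler_pdivlMr//.
apply: (@le_trans _ _ (`|s| * N (unit_dir x))).
  by rewrite ler_wpM2r ?is_norm_ge0// ler_norm.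
rewrite -(is_normZ hN) -along_dir.
have -> : along x s 0 = along x s t - along x 0 t.
  by rewrite -[- along _ _ _]scaleN1r alongZ alongD scaleN1r subrr mulr0 addr0.
apply: (le_trans (is_normD hN _ _)); rewrite (is_normN hN) lerD2r.
exact: ltW.
Qed.

Let fiberE t : [set s | ball_diff (tau *: x) 0 1 (along x s t)] =
  [set s | S t (s - l) /\ ~ S t s].
Proof.
have E s : along x s t - tau *: x = along x (s - l) t.
  rewrite {2}(unit_dirE x0) scalerA -/l -along_dir -[- along _ _ _]scaleN1r alongZ.
  by rewrite alongD scaler0 addr0 mulN1r.
by apply/seteqP; split => s; rewrite /ball_diff /open_ball /S/= E subr0.
Qed.

Let polarE : (l%:E * vol (shadow N x) = (tau * pN x)%:E)%E.
Proof.
rewrite -(@fineK _ (vol (shadow N x))); last first.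
  by rewrite ge0_fin_numE// vol_shadow_ltoo.
by rewrite -EFinM; congr EFin; rewrite /l /polar_projection_norm mulrAC -mulrA.
Qed.

(** Each line over the shadow contributes at most the length tau |x| of the
    shift. *)
Lemma vol_ball_diff_le : (vol (ball_diff (tau *: x) 0 1) <= (tau * pN x)%:E)%E.
Proof.
rewrite -polarE; apply: (@vol_along_le _ _ x) => //.
- exact: ltW.
- exact: measurable_ball_diff.
- exact: measurable_shadow.
- move=> t nt s bs; apply: nt; apply/shadowP => //; exists (s - l).
  have : [set s | ball_diff (tau *: x) 0 1 (along x s t)] s by [].
  by rewrite fiberE => -[/ltW].
- move=> t; rewrite fiberE; apply: (shift_diff_le (mS t) _ _ l0).
  + exact: convS.
  + exact: bdS.
Qed.

(** Over the shadow shrunk by 1 - tau N(x), convexity thickens each chord to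
    length at least tau |x|, so these lines contribute the full length of the
    shift. *)
Lemma vol_ball_diff_ge : tau * N x < 1 ->
  ((tau * pN x * (1 - tau * N x) ^+ n)%:E <= vol (ball_diff (tau *: x) 0 1))%E.
Proof.
set d := tau * N x => d1.
have d0 : 0 < d by rewrite mulr_gt0// is_norm_gt0.
have c0 : 0 < (1 - d)^-1 by rewrite invr_gt0 subr_gt0.
have := vol_scale c0 (measurable_shadow hN x0).
rewrite -exprVn invrK => volE.
rewrite EFinM -polarE -muleA [(vol _ * _)%E]muleC -volE.
apply: (@vol_along_ge _ _ x) => //.
- exact: ltW.
- exact: measurable_ball_diff.
- exact: measurable_preim (measurable_row_scale _) (measurable_shadow hN x0).
- move=> t /= /(shadowP _ _ x0)[s Ns].
  (* The chord of the shrunk line contains the segment of half-length l / 2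
     around (1 - d) s: shrinking leaves N at most 1 - d, moving along the
     segment adds at most d / 2. *)
  have Sc s' : `|s' - (1 - d) * s| <= l / 2 -> S t s'.
    move=> h; rewrite /S/=.
    have -> : along x s' t = (1 - d) *: along x s ((1 - d)^-1 *: t) +
        (s' - (1 - d) * s) *: unit_dir x.
      rewrite -along_dir alongZ alongD addr0 scalerA divff ?gt_eqF ?subr_gt0//.
      by rewrite scale1r addrC subrK.
    apply: (le_lt_trans (is_normD hN _ _)).
    rewrite (is_normZ hN (1 - d)) (is_normZ hN (s' - (1 - d) * s)).
    have h1 : `|1 - d| * N (along x s ((1 - d)^-1 *: t)) <= 1 - d.
      by rewrite gtr0_norm ?subr_gt0// ger_pMr// subr_gt0.
    have h2 : `|s' - (1 - d) * s| * N (unit_dir x) <= d / 2.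
      apply: (@le_trans _ _ (l / 2 * N (unit_dir x))).
        by rewrite ler_wpM2r// is_norm_ge0.
      have Nx : N x = l2norm x * N (unit_dir x).
        by rewrite {1}(unit_dirE x0) [LHS](is_normZ hN) gtr0_norm// l2norm_gt0.
      rewrite /d Nx /l le_eqVlt; apply/orP; left; apply/eqP; ring.
    by apply: (le_lt_trans (lerD h1 h2)); lra.
  rewrite fiberE.
  apply: (@shift_diff_ge _ (S t) l _ (mS t) (@convS t) (@bdS t) l0
     ((1 - d) * s - l / 2) ((1 - d) * s + l / 2)).
  + by apply: Sc; rewrite addrAC subrr add0r normrN ger0_norm// divr_ge0// ltW.
  + by apply: Sc; rewrite addrAC subrr add0r ger0_norm// divr_ge0// ltW.
  + lra.
Qed.

End fiber.

Lemma polar_gt0 x : x != 0 -> 0 < pN x.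
Proof.
move=> x0; rewrite /polar_projection_norm mulr_gt0 ?l2norm_gt0//.
by apply: fine_gt0; rewrite vol_shadow_gt0 ?vol_shadow_ltoo.
Qed.

Lemma polar0 : pN 0 = 0.
Proof.
rewrite /polar_projection_norm (_ : l2norm 0 = 0) ?mulr0//.
rewrite /l2norm (_ : dotp 0 0 = 0) ?sqrtr0//.
by rewrite -(scale0r (0 : V)) dotpZl mul0r.
Qed.

Lemma polar_ge0 x : 0 <= pN x.
Proof.
by have [->|x0] := eqVneq x 0; [rewrite polar0|exact/ltW/polar_gt0].
Qed.

Lemma polarN x : pN (- x) = pN x.
Proof.
have dN : dotp (- x) (- x) = dotp x x.
  by rewrite -scaleN1r dotpZl dotpC dotpZl !mulN1r opprK.
rewrite /polar_projection_norm /l2norm dN; congr (fine _ * _).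
rewrite /vol_perp.
have -> : perp_frame (- x) = perp_frame x.
  rewrite /perp_frame; congr (xget 0 _); apply/seteqP; split => U /=.
    by rewrite linearN/= mulmxN => -[-> /eqP]; rewrite oppr_eq0 => /eqP ->.
  by rewrite linearN/= mulmxN => -[-> ->]; rewrite oppr0.
have E v : orth_proj (- x) v = orth_proj x v.
  rewrite /orth_proj dN; have -> : dotp v (- x) = - dotp v x.
    by rewrite dotpC -scaleN1r dotpZl mulN1r dotpC.
  by rewrite mulNr scaleNr scalerN opprK.
by congr vol; apply/seteqP; split => t [v Bv vt]; exists v; rewrite // -vt E.
Qed.

Lemma vol_ball_diff_triangle x y z r :
  (vol (ball_diff x z r) <= vol (ball_diff x y r) + vol (ball_diff y z r))%E.
Proof.
apply: (@le_trans _ _ (vol (ball_diff x y r `|` ball_diff y z r))).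
  apply: le_measure; rewrite ?inE.
  - exact: measurable_ball_diff.
  - by apply: measurableU; exact: measurable_ball_diff.
  - move=> v [vx vz]; have [vy|vy] := pselect (open_ball N y r v); [right|left]; by split.
by apply: measureU2; exact: measurable_ball_diff.
Qed.

(** Difference volumes are subadditive, and tau p is their first-order term at
    scale tau. *)
Lemma polarD x y : pN (x + y) <= pN x + pN y.
Proof.
have [->|xy0] := eqVneq (x + y) 0; first by rewrite polar0 addr_ge0// polar_ge0.
have Nxy : 0 < N (x + y) by exact: is_norm_gt0.
apply: (@le_of_pow_limit _ _ _ n); first exact: polar_ge0.
(* The scale at which the loss 1 - tau N (x + y) is 1 - d. *)
move=> d /andP[d0 d1]; pose tau := d / N (x + y).
have tau0 : 0 < tau by rewrite divr_gt0.
have dE : d = tau * N (x + y) by rewrite /tau divfK// gt_eqF.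
have tE u : (vol (ball_diff (tau *: u) 0 1) <= (tau * pN u)%:E)%E.
  have [->|u0] := eqVneq u 0; last exact: vol_ball_diff_le.
  by rewrite scaler0 /ball_diff setDv measure0 polar0 mulr0.
have := vol_ball_diff_ge xy0 tau0; rewrite -dE => /(_ d1).
have h : (vol (ball_diff (tau *: (x + y)) 0 1) <= (tau * pN x)%:E + (tau * pN y)%:E)%E.
  apply: (le_trans (vol_ball_diff_triangle _ (tau *: y) _ _)).
  apply: leeD => //; rewrite scalerDr -[X in ball_diff _ X _]add0r.
  by rewrite vol_ball_diff_shift.
move=> /le_trans/(_ h); rewrite -EFinD lee_fin -mulrDr -mulrA ler_pM2l//.
Qed.

End ball_difference.

(** * The uniform law on the unit interval and binary digits *)

Section uniform_measure.
Variable R : realType.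
Local Notation mR := (measurableTypeR R).

Definition unif : set mR -> \bar R :=
  mrestr (@lebesgue_measure R) (measurable_itv `[0, 1[).

HB.instance Definition _ := Measure.on unif.

Lemma unifE (A : set mR) : unif A = @lebesgue_measure R (A `&` `[0, 1[%classic).
Proof. by []. Qed.

Let unif_setT : unif setT = 1%E.
Proof. by rewrite unifE setTI lebesgue_measure_itv/= lte01 sube0. Qed.

HB.instance Definition _ := Measure_isProbability.Build _ _ R unif unif_setT.

Definition msb (x : R) : bool := 2^-1 <= x.
(** The doubling map, which drops the first binary digit. *)
Definition dbl (x : R) : R := 2 * x - (msb x)%:R.

(** Doubling maps each half of the unit interval affinely onto the whole, so the
    first binary digit is fair and independent of the others. *)
Lemma unif_dbl (c : bool) (A : set mR) : measurable A ->
  unif [set x | msb x = c /\ A (dbl x)] = (2^-1%:E * unif A)%E.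
Proof.
move=> mA; have mA1 : measurable (A `&` `[0, 1[%classic : set mR).
  by apply: measurableI => //; exact: measurable_itv.
have two0 : 0 < 2 :> R by [].
rewrite !unifE -(lebesgue_measure_affine (- c%:R) two0 mA1).
congr (lebesgue_measure _); apply/seteqP; split => x /=; rewrite !in_itv/= /dbl /msb.
  move=> [[<- Ax] /andP[x0 x1]]; split => //.
  by case: (lerP 2^-1 x) => h /=; lra.
case: c => /= -[Ax /andP[x0 x1]].
  have h : (2^-1 <= x) = true by apply/idP; lra.
  by rewrite h; split => //; lra.
have h : (2^-1 <= x) = false by apply/negbTE; rewrite -ltNge; lra.
by rewrite h; split => //; lra.
Qed.

Lemma unif_split (E : set mR) (A : bool -> set mR) : measurable E ->
  (forall c, measurable (A c)) -> (forall x, E x <-> A (msb x) (dbl x)) ->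
  unif E = (2^-1%:E * (unif (A false) + unif (A true)))%E.
Proof.
move=> mE mA EA.
have mmsb c : measurable ([set x | msb x = c] : set mR).
  have m1 : measurable ([set x | msb x = true] : set mR).
    have := measurable_itv `[2^-1, +oo[ : measurable (_ : set mR).
    by congr measurable; apply/seteqP; split => x /=; rewrite in_itv/= andbT.
  case: c => //; rewrite (_ : [set x | _] = ~` [set x | msb x = true]).
    exact: measurableC.
  by apply/seteqP; split => x /=; [move=> ->|case: (msb x)].
have EE : E = (E `&` [set x | msb x = false]) `|` (E `&` [set x | msb x = true]).
  rewrite -setIUr (_ : _ `|` _ = setT) ?setIT//.
  by apply/seteqP; split => // x _ /=; case: (msb x); [right|left].
rewrite EE measureU; last 3 first.
- exact: measurableI.
- exact: measurableI.
- by apply/seteqP; split => // x /= [[_ ->] []].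
rewrite muleDr; last 2 first.
- by [].
- by apply: ge0_adde_def; rewrite inE.
rewrite -(unif_dbl false)// -(unif_dbl true)//; congr (unif _ + unif _)%E.
  by apply/seteqP; split => x [] /=; [by move=> /EA + h; rewrite h|
    move=> h Ax; split => //; apply/EA; rewrite h].
by apply/seteqP; split => x [] /=; [by move=> /EA + h; rewrite h|
  move=> h Ax; split => //; apply/EA; rewrite h].
Qed.

Lemma measurable_dbl : measurable_fun setT (dbl : mR -> mR).
Proof.
apply: measurable_funB; first exact: measurable_funM.
rewrite (_ : (fun x => _) = \1_(`[2^-1, +oo[%classic : set mR)).
  by apply: measurable_indic; exact: measurable_itv.
apply/funext => x; rewrite indicE /msb; congr (_%:R); apply/esym.
by congr nat_of_bool; apply/idP/idP; rewrite inE/= in_itv/= andbT.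
Qed.

(** The number whose binary digits are those of x at positions 0, 2, 4, ..,
    truncated after m digits. *)
Fixpoint evenbits_sum (m : nat) (x : R) : R :=
  if m is k.+1 then ((msb x)%:R + evenbits_sum k (dbl (dbl x))) / 2 else 0.

Definition evenbits (x : R) : R := limn (fun m => evenbits_sum m x).
Definition oddbits (x : R) : R := evenbits (dbl x).

Lemma evenbits_sum_itv m x : 0 <= evenbits_sum m x <= 1.
Proof.
elim: m x => [|m ih] x /=; first by rewrite lexx ler01.
by have := ih (dbl (dbl x)); case: (msb x) => /=; lra.
Qed.

Lemma evenbits_sum_nd x : nondecreasing_seq (fun m => evenbits_sum m x).
Proof.
apply/nondecreasing_seqP => m; elim: m x => [|m ih] x.
  by have /andP[] := evenbits_sum_itv 1 x.
rewrite [leLHS]/= [leRHS]/= ler_pM2r ?invr_gt0// lerD2l.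
exact: ih.
Qed.

Lemma is_cvg_evenbits_sum x : cvgn (evenbits_sum ^~ x).
Proof.
apply: nondecreasing_is_cvgn; first exact: evenbits_sum_nd.
by exists 1 => _ [m _ <-]; have /andP[] := evenbits_sum_itv m x.
Qed.

Lemma evenbits_cvg x : evenbits_sum m x @[m --> \oo] --> evenbits x.
Proof. exact: is_cvg_evenbits_sum. Qed.

(** Dropping one digit exchanges even and odd positions: this self-similarity
    determines the joint law. *)
Lemma evenbitsE x : evenbits x = ((msb x)%:R + oddbits (dbl x)) / 2.
Proof.
apply: (@cvg_unique _ (@Rhausdorff R) (evenbits_sum m.+1 x @[m --> \oo])).
  by have := @is_cvg_evenbits_sum x; rewrite -(cvg_shiftS (evenbits_sum ^~ x)).
apply: cvgMl; apply: cvgD; first exact: cvg_cst.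
exact: evenbits_cvg.
Qed.

Lemma evenbits_itv x : 0 <= evenbits x <= 1.
Proof.
apply/andP; split.
  apply: limr_ge; first exact: is_cvg_evenbits_sum.
  by near=> m; have /andP[] := evenbits_sum_itv m x.
apply: limr_le; first exact: is_cvg_evenbits_sum.
by near=> m; have /andP[] := evenbits_sum_itv m x.
Unshelve. all: by end_near. Qed.

Lemma measurable_evenbits : measurable_fun setT (evenbits : mR -> mR).
Proof.
apply: (@measurable_fun_cvg _ _ _ _ (fun m x => evenbits_sum m x)); last first.
  by move=> x _; exact: evenbits_cvg.
elim=> [|m ih]; first exact: measurable_cst.
apply: measurable_funM => //; apply: measurable_funD.
  rewrite (_ : (fun x => _) = (fun x => 2 * x - dbl x)).
    by apply: measurable_funB; [exact: measurable_funM|exact: measurable_dbl].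
  by apply/funext => x; rewrite /dbl opprB addrC subrK.
apply: (measurableT_comp ih).
by apply: (measurableT_comp measurable_dbl); exact: measurable_dbl.
Qed.

Lemma measurable_oddbits : measurable_fun setT (oddbits : mR -> mR).
Proof. by apply: (measurableT_comp measurable_evenbits); exact: measurable_dbl. Qed.

End uniform_measure.

(** * Joint law of the even and the odd digits *)

Section self_similar_cdf.
Variable R : realType.

(** The distribution function of the uniform law on [0, 1[. *)
Definition clip (s : R) : R := if s <= 0 then 0 else if 1 < s then 1 else s.

Lemma clip_le0 s : s <= 0 -> clip s = 0.
Proof. by rewrite /clip => ->. Qed.

Lemma clip_gt1 s : 1 < s -> clip s = 1.
Proof. by move=> s1; rewrite /clip s1 leNgt (lt_trans ltr01 s1). Qed.

Lemma clip_id s : 0 < s -> s <= 1 -> clip s = s.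
Proof. by move=> s0 s1; rewrite /clip leNgt s0 ltNge s1. Qed.

Lemma eq_of_geometric (a b : R) : (forall k, `|a - b| <= 2^-1 ^+ k) -> a = b.
Proof.
move=> h; apply/eqP; rewrite -subr_eq0 -normr_le0.
rewrite leNgt; apply/negP => ab.
have [k hk] : exists k : nat, 2^-1 ^+ k < `|a - b|.
  exists (Num.truncn `|a - b|^-1).+1.
  apply: (@le_lt_trans _ _ (Num.truncn `|a - b|^-1).+1%:R^-1); last first.
    by rewrite invf_plt ?posrE// Num.Theory.truncnS_gt.
  rewrite exprVn lef_pV2 ?posrE ?exprn_gt0// -natrX ler_nat.
  exact/ltnW/ltn_expl.
by have := h k; rewrite leNgt hk.
Qed.

Variable J : R -> R -> R.
Hypothesis J01 : forall s t, 0 <= J s t <= 1.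
Hypothesis Jrec : forall s t, J s t = (J t (2 * s) + J t (2 * s - 1)) / 2.
Hypothesis J0l : forall s t, s <= 0 -> J s t = 0.
Hypothesis J0r : forall s t, t <= 0 -> J s t = 0.
Hypothesis J1l : forall s t, 1 < s -> J s t = J 2 t.
Hypothesis J1r : forall s t, 1 < t -> J s t = J s 2.
Hypothesis J22 : J 2 2 = 1.

Let clip01 s : 0 <= clip s <= 1.
Proof. by rewrite /clip; case: ifPn => [_|]; [|rewrite -ltNge => s0; case: ltP]; lra. Qed.

Let geometric_half (a b c d : R) k : a - b = (c - d) / 2 -> `|c - d| <= 2^-1 ^+ k ->
  `|a - b| <= 2^-1 ^+ k.+1.
Proof.
move=> -> h; rewrite normrM exprS mulrC ler_pM//.
by rewrite ger0_norm.
Qed.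

Let J_swap2 t : J 2 t = J t 2.
Proof. by rewrite Jrec [J t (2 * 2)]J1r ?[J t (2 * 2 - 1)]J1r; lra. Qed.

Let J_marginal s : J s 2 = clip s.
Proof.
apply: eq_of_geometric => k; elim: k s => [|k ih] s.
  by rewrite expr0 ler_distl; have := J01 s 2; have := clip01 s; lra.
have e0 : 0 <= 2^-1 ^+ k.+1 :> R by rewrite exprn_ge0.
have [s0|s0] := leP s 0; first by rewrite J0l// clip_le0// subrr normr0.
have [s1|s1] := ltP 1 s; first by rewrite J1l// J22 clip_gt1// subrr normr0.
have [h|h] := leP s 2^-1.
  apply: geometric_half (ih (2 * s)).
  rewrite Jrec [J 2 (2 * s - 1)]J0r; last by lra.
  by rewrite J_swap2 !clip_id; lra.
apply: geometric_half (ih (2 * s - 1)).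
rewrite Jrec [J 2 (2 * s)]J1r ?J22; last by lra.
by rewrite J_swap2 !clip_id; lra.
Qed.

(** The recursion determines J: the difference of two solutions vanishes outside
    the unit square, by the same argument in one variable for the marginals, and
    inside it one of the two terms on the right of the recursion falls outside,
    so that each application of the recursion halves the difference. *)
Lemma self_similar_cdf s t : J s t = clip s * clip t.
Proof.
apply: eq_of_geometric => k; elim: k s t => [|k ih] s t.
  rewrite expr0 ler_distl; have := J01 s t; have := clip01 s; have := clip01 t.
  move=> /andP[t0 t1] /andP[s0 s1] /andP[j0 j1].
  have p0 : 0 <= clip s * clip t by rewrite mulr_ge0.
  have p1 : clip s * clip t <= 1 by rewrite mulr_ile1.
  lra.
have e0 : 0 <= 2^-1 ^+ k.+1 :> R by rewrite exprn_ge0.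
have [s0|s0] := leP s 0; first by rewrite J0l// clip_le0// mul0r subrr normr0.
have [t0|t0] := leP t 0; first by rewrite J0r// (clip_le0 t0) mulr0 subrr normr0.
have [s1|s1] := ltP 1 s.
  by rewrite J1l// J_swap2 J_marginal (clip_gt1 s1) mul1r subrr normr0.
have [t1|t1] := ltP 1 t.
  by rewrite J1r// J_marginal (clip_gt1 t1) mulr1 subrr normr0.
have [h|h] := leP s 2^-1.
  apply: geometric_half (ih t (2 * s)).
  rewrite Jrec [J t (2 * s - 1)]J0r; last by lra.
  rewrite (clip_id s0 s1) (clip_id t0 t1) (@clip_id (2 * s)); [by field|by lra|by lra].
apply: geometric_half (ih t (2 * s - 1)).
rewrite Jrec [J t (2 * s)]J1r ?J_marginal; last by lra.
rewrite (clip_id s0 s1) (clip_id t0 t1) (@clip_id (2 * s - 1)); [by field|by lra|by lra].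
Qed.

End self_similar_cdf.

Section bits_independent.
Variable R : realType.
Local Notation mR := (measurableTypeR R).
Local Notation unif := (@unif R).

Let event s t := [set x : mR | evenbits x < s /\ oddbits x < t].

Let measurable_lt (f : mR -> mR) s : measurable_fun setT f ->
  measurable [set x | f x < s].
Proof.
move=> mf; have := mf measurableT `]-oo, s[%classic (measurable_itv _).
by rewrite setTI; congr measurable; apply/seteqP; split => x; rewrite /= in_itv.
Qed.

Let mevent s t : measurable (event s t).
Proof.
apply: measurableI; apply: measurable_lt; first exact: measurable_evenbits.
exact: measurable_oddbits.
Qed.

Let J s t := fine (unif (event s t)).

Let JE s t : unif (event s t) = (J s t)%:E.
Proof. by rewrite fineK// fin_num_measure. Qed.

Lemma unif_lt s : unif [set x | x < s] = (clip s)%:E.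
Proof.
rewrite unifE; have [s0|s0] := leP s 0.
  rewrite clip_le0// (_ : _ `&` _ = set0) ?measure0//.
  by apply/seteqP; split => // x [/= xs]; rewrite in_itv/= => /andP[]; lra.
have [s1|s1] := ltP 1 s.
  rewrite clip_gt1// (_ : _ `&` _ = `[0, 1[%classic); last first.
    by apply/seteqP; split => x /= => [[]//|]; rewrite in_itv/= => /andP[x0 x1]; split; lra.
  by rewrite lebesgue_measure_itv/= lte01 sube0.
rewrite clip_id// (_ : _ `&` _ = `[0, s[%classic); last first.
  by apply/seteqP; split => x /=; rewrite !in_itv/=; lra.
by rewrite lebesgue_measure_itv/= lte_fin s0 sube0.
Qed.

Lemma unif_bits_lt s t : unif (event s t) = (clip s * clip t)%:E.
Proof.
rewrite JE; congr EFin; apply: (self_similar_cdf (J := J)).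
- by move=> {}s {}t; rewrite -!lee_fin -JE measure_ge0 probability_le1.
- move=> {}s {}t; apply: EFin_inj; rewrite -JE.
  rewrite (@unif_split _ _ (fun c => event t (2 * s - c%:R)))//.
    by rewrite !JE mulr0n subr0 -EFinD -EFinM; congr EFin; rewrite mulrC.
  move=> x; rewrite /event/= /oddbits [evenbits x]evenbitsE /oddbits.
  by split=> -[h1 h2]; split => //; lra.
- move=> {}s {}t s0; rewrite /J (_ : event s t = set0) ?measure0//.
  by apply/seteqP; split => // x [/=]; have := evenbits_itv x; lra.
- move=> {}s {}t t0; rewrite /J (_ : event s t = set0) ?measure0//.
  by apply/seteqP; split => // x [/=]; have := evenbits_itv (dbl x); rewrite /oddbits; lra.
- move=> {}s {}t s1; congr (fine (unif _)).
  apply/seteqP; split => x [/=]; have := evenbits_itv x;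
    by rewrite /event/= => h1 h2 h3; split => //; lra.
- move=> {}s {}t t1; congr (fine (unif _)).
  apply/seteqP; split => x [/=]; have := evenbits_itv (dbl x);
    by rewrite /event/= /oddbits => h1 h2 h3; split => //; lra.
- rewrite /J (_ : event 2 2 = setT) ?probability_setT//.
  apply/seteqP; split => x _ //=; rewrite /event/= /oddbits.
  by have := evenbits_itv (dbl x); have := evenbits_itv x => h1 h2; split; lra.
Qed.

End bits_independent.

(** * Splitting a uniform number into a uniform vector and a fresh number *)

Section independent_bits.
Variable R : realType.
Local Notation mR := (measurableTypeR R).
Local Notation unif := (@unif R).

(** Half-lines form a pi-system generating the Borel sets. *)
Lemma eq_measure_lt (m1 m2 : {measure set mR -> \bar R}) : (m1 setT < +oo)%E ->
  (forall s, m1 [set x | x < s] = m2 [set x | x < s]) ->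
  forall A, measurable A -> m1 A = m2 A.
Proof.
move=> m1oo m12 A mA.
have E s : [set x : R | x < s] = `]-oo, s[%classic.
  by apply/seteqP; split => x; rewrite /= in_itv.
have Gx : measurable = <<s @RGenInftyO.G R >> :> set (set mR).
  exact: RGenInftyO.measurableE.
apply: (@measure_unique _ R mR (@RGenInftyO.G R) (fun k => `]-oo, k%:R[%classic)
  Gx _ _ _ m1 m2 _ _ A mA) => //.
- move=> _ _ [x ->] [y ->]; exists (Num.min x y); apply/seteqP.
  by split=> z; rewrite /= !in_itv/= lt_min; [move=> [-> ->]|move=> /andP].
- by move=> i; exists i%:R.
- apply/seteqP; split => // x _; exists (Num.truncn x).+1 => //=.
  by rewrite in_itv/= Num.Theory.truncnS_gt.
- by move=> _ [s ->]; rewrite -E.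
- move=> k; apply: le_lt_trans m1oo; apply: le_measure; rewrite ?inE//.
Qed.

(** Two successive applications of [eq_measure_lt], one for each factor,
    starting from half-lines. *)
Lemma unif_bits_rect (A B : set mR) : measurable A -> measurable B ->
  unif [set x | A (evenbits x) /\ B (oddbits x)] = (unif A * unif B)%E.
Proof.
move=> mA mB.
have clip0 t : 0 <= clip t :> R.
  by rewrite -lee_fin -unif_lt.
have m_lt t : measurable ([set x | x < t] : set mR).
  have := measurable_itv `]-oo, t[ : measurable (_ : set mR).
  by congr measurable; apply/seteqP; split => x; rewrite /= in_itv.
have mo (C : set mR) : measurable C -> measurable ([set x | C (oddbits x)] : set mR).
  by move=> mC; exact: measurable_preim (@measurable_oddbits R) mC.
have me (C : set mR) : measurable C -> measurable ([set x | C (evenbits x)] : set mR).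
  by move=> mC; exact: measurable_preim (@measurable_evenbits R) mC.
have step t : unif [set x | A (evenbits x) /\ oddbits x < t] = (unif A * (clip t)%:E)%E.
  pose m1 := image_measure (mrestr unif (mo _ (m_lt t))) (@measurable_evenbits R).
  pose m2 := mscale (NngNum (clip0 t)) unif.
  transitivity (m2 A); last by rewrite /m2 /mscale/= muleC.
  transitivity (m1 A); first by [].
  apply: (@eq_measure_lt m1 m2) => //.
    apply: le_lt_trans (ltry 1); rewrite /m1 /image_measure /pushforward /mrestr.
    by apply: probability_le1; apply: measurableI; [exact: (me setT)|exact: (mo _ (m_lt t))].
  move=> s; transitivity ((clip t)%:E * (clip s)%:E)%E; last by rewrite -(unif_lt s).
  by rewrite -EFinM mulrC; exact: unif_bits_lt.
pose m1 := image_measure (mrestr unif (me _ mA)) (@measurable_oddbits R).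
have fA : unif A = (fine (unif A))%:E by rewrite fineK// fin_num_measure.
have fA0 : 0 <= fine (unif A) by rewrite fine_ge0.
pose m2 := mscale (NngNum fA0) unif.
transitivity (m2 B); last by rewrite /m2 /mscale/= -fA.
transitivity (m1 B); first by congr unif; apply/seteqP; split => x [].
apply: (@eq_measure_lt m1 m2) => //.
- apply: le_lt_trans (ltry 1); rewrite /m1 /image_measure /pushforward /mrestr.
  by apply: probability_le1; apply: measurableI; [exact: (mo setT)|exact: (me _ mA)].
- move=> s; transitivity (unif A * (clip s)%:E)%E; last first.
    by rewrite [X in (X * _)%E]fA -(unif_lt s).
  by rewrite -step; congr unif; apply/seteqP; split => x [].
Qed.

Lemma measurable_bits :
  measurable_fun setT (fun x : mR => (evenbits x, oddbits x) : mR * mR).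
Proof.
by apply: measurable_fun_pair; [exact: measurable_evenbits|exact: measurable_oddbits].
Qed.

(** Rectangles determine a measure on the product. *)
Lemma unif_bits (X : set (mR * mR)) : measurable X ->
  unif [set x | X (evenbits x, oddbits x)] = (unif \x unif)%E X.
Proof.
move=> mX.
rewrite (@product_measure_unique _ _ _ _ _ _ _ (image_measure unif measurable_bits))//.
move=> A B mA mB; rewrite /image_measure /pushforward -unif_bits_rect//.
Qed.

End independent_bits.

Section uniform_vector.
Variable R : realType.
Local Notation mR := (measurableTypeR R).
Local Notation unif := (@unif R).

Definition unit_cell n : set 'rV[R]_n := [set v | forall i, `[0, 1[%classic (v ord0 i)].

Lemma measurable_unit_cell n : measurable (@unit_cell n).
Proof.
apply: measurable_forall => i.
have := @measurable_coord R n i measurableT `[0, 1[%classic.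
by rewrite setTI; apply; exact: measurable_itv.
Qed.

Definition cell_vol n : set 'rV[R]_n -> \bar R :=
  mrestr (@vol R n) (@measurable_unit_cell n).

HB.instance Definition _ n := Measure.on (@cell_vol n).

Lemma cell_vol_setT n : @cell_vol n setT = 1%E.
Proof.
rewrite /cell_vol /mrestr setTI vol_box; last exact: measurable_itv.
rewrite lebesgue_measure_itv/= lte01 sube0.
by elim: n => [//|n ih]; rewrite expeS ih mule1.
Qed.

HB.instance Definition _ n :=
  Measure_isProbability.Build _ _ R (@cell_vol n) (cell_vol_setT n).

Lemma measurable_fun_row_cons d (S : measurableType d) n (f : S -> mR) (g : S -> 'rV[R]_n) :
  measurable_fun setT f -> measurable_fun setT g ->
  measurable_fun setT (fun x => row_cons (f x) (g x)).
Proof.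
move=> mf mg.
have := measurableT_comp (@measurable_row_cons R n) (measurable_fun_pair mf mg).
by apply: eq_measurable_fun.
Qed.

Lemma cell_vol_row_cons n (A : set 'rV[R]_n.+1) : measurable A ->
  cell_vol A = (unif \x @cell_vol n)%E [set p | A (row_cons p.1 p.2)].
Proof.
move=> mA.
have mB : measurable [set p : mR * 'rV[R]_n | A (row_cons p.1 p.2)].
  exact: measurable_preim (@measurable_row_cons R n) mA.
have mD : measurable (`[0, 1[%classic `*` @unit_cell n : set (mR * 'rV[R]_n)).
  by apply: measurableX; [exact: measurable_itv|exact: measurable_unit_cell].
rewrite (@product_measure_unique _ _ _ _ _ _ _
  (mrestr (@lebesgue_measure R \x @vol R n)%E mD))//.
  rewrite /cell_vol /mrestr vol_row_cons; congr (_ _).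
  have E a v : unit_cell (row_cons a v) <-> `[0, 1[%classic a /\ @unit_cell n v.
    exact: (row_consP a v (fun=> `[0, 1[%classic)).
  by apply/seteqP; split => p [Ap /E].
move=> B C mB' mC.
transitivity ((@lebesgue_measure R \x @vol R n)%E
    ((B `&` `[0, 1[%classic) `*` (C `&` @unit_cell n))).
  have e : (B `*` C) `&` (`[0, 1[%classic `*` @unit_cell n) =
      (B `&` `[0, 1[%classic) `*` (C `&` @unit_cell n).
    by apply/seteqP; split => p [[? ?] [? ?]].
  exact: (congr1 (@lebesgue_measure R \x @vol R n)%E e).
apply: product_measure1E.
  by apply: (measurableI _ _ mB'); exact: measurable_itv.
by apply: (measurableI _ _ mC); exact: measurable_unit_cell.
Qed.

(** Peels off n independent uniform coordinates and returns the digits that are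
    left as a new uniform number. *)
Fixpoint split_vector n (w : mR) : 'rV[R]_n * mR :=
  if n is k.+1 then let p := split_vector k (oddbits w) in
    (row_cons (evenbits w) p.1, p.2)
  else (0, w).

Lemma measurable_split_vector n : measurable_fun setT (split_vector n).
Proof.
elim: n => [|n ih] /=.
  by apply: measurable_fun_pair; [exact: measurable_cst|exact: measurable_id].
have mo : measurable_fun setT (fun w : mR => split_vector n (oddbits w)).
  by apply: (measurableT_comp ih); exact: measurable_oddbits.
apply: measurable_fun_pair; last exact: (measurableT_comp measurable_snd mo).
apply: measurable_fun_row_cons; first exact: measurable_evenbits.
exact: (measurableT_comp measurable_fst mo).
Qed.

(** Induction on n: [unif_bits] splits off one coordinate, over which the
    induction hypothesis is integrated. *)
Lemma unif_split_vector n (A : set 'rV[R]_n) (E : set mR) : measurable A -> measurable E ->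
  unif [set w | A (split_vector n w).1 /\ E (split_vector n w).2] = (cell_vol A * unif E)%E.
Proof.
elim: n A => [|n ih] A mA mE /=.
  have -> : cell_vol A = (\1_A 0)%:E.
    have [A0|A0] := pselect (A 0).
      rewrite indicE mem_set// -(cell_vol_setT 0); congr cell_vol.
      apply/seteqP; split => // v _; rewrite (_ : v = 0)//.
      by apply/rowP => -[].
    rewrite indicE memNset//=; transitivity (@cell_vol 0 set0); last exact: measure0.
    congr cell_vol; apply/seteqP; split => // v Av; apply: A0; rewrite (_ : 0 = v)//.
    by apply/rowP => -[].
  rewrite indicE; have [A0|A0] := pselect (A 0).
    rewrite mem_set// mul1e; congr unif.
    by apply/seteqP; split => w // -[].
  rewrite memNset// mul0e; transitivity (unif set0); last exact: measure0.
  congr unif.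
  by apply/seteqP; split => w // -[].
pose X := [set p : mR * mR | A (row_cons p.1 (split_vector n p.2).1) /\
  E (split_vector n p.2).2].
have m2 : measurable_fun setT (fun p : mR * mR => split_vector n p.2).
  rewrite (_ : (fun p => _) = split_vector n \o snd)//.
  by apply: measurableT_comp; [exact: measurable_split_vector|exact: measurable_snd].
have mX : measurable X.
  apply: measurableI; last first.
    by apply: measurable_preim mE; exact: (measurableT_comp measurable_snd m2).
  apply: (@measurable_preim _ _ _ _
    (fun p : mR * mR => row_cons p.1 (split_vector n p.2).1)) => //.
  apply: measurable_fun_row_cons; first exact: measurable_fst.
  exact: (measurableT_comp measurable_fst m2).
have mB : measurable [set p : mR * 'rV[R]_n | A (row_cons p.1 p.2)].
  exact: measurable_preim (@measurable_row_cons R n) mA.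
rewrite [LHS](unif_bits mX) cell_vol_row_cons// /product_measure1.
rewrite -ge0_integralZr//; last exact: measurable_fun_xsection.
apply: eq_integral => a _ /=.
have mAa : measurable [set v | A (row_cons a v)].
  have := measurable_xsection a mB; congr measurable.
  by apply/seteqP; split => v; [move/xsectionP|move=> h; apply/xsectionP].
have -> : xsection X a =
    [set w | A (row_cons a (split_vector n w).1) /\ E (split_vector n w).2].
  by apply/seteqP; split => v; [move/xsectionP|move=> h; apply/xsectionP].
rewrite (ih _ mAa mE); congr (cell_vol _ * _)%E.
by apply/seteqP; split => v; [move=> h; apply/xsectionP|move/xsectionP].
Qed.

End uniform_vector.

(** * Measurability of hitting events *)

Section hitting_events.
Variables (R : realType) (m : nat) (N : 'rV[R]_m -> R).
Hypothesis hN : is_norm N.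
Local Notation V := 'rV[R]_m.

(** Bolzano-Weierstrass theorem for N. *)
Lemma is_norm_cluster (u : nat -> V) (K : R) : (forall p, N (u p) <= K) ->
  exists y, forall e, 0 < e -> forall P, exists2 p, (P <= p)%N & N (u p - y) < e.
Proof.
move=> uK; have [c c0 cN] := is_norm_ge_sup hN; have [C C0 NC] := is_norm_le_sup hN.
have cK : compact [set v : V | `|v| <= K / c].
  apply: bounded_closed_compact.
    exists (K / c); split=> [|M M1 x /= xK]; first exact: num_real.
    exact/ltW/(le_lt_trans xK).
  apply: (@preimage_closed _ _ (fun x : V => `|x|) [set r | r <= K / c]).
    by move=> x _; exact: norm_continuous.
  exact: closed_le.
have [|y [_ cy]] := cK (u @ \oo) _.
  by exists 0 => // p _ /=; rewrite ler_pdivlMr// mulrC (le_trans (cN _)).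
exists y => e e0 P.
have uP : (u @ \oo) [set v | exists2 p, (P <= p)%N & v = u p].
  by exists P => // p /= Pp; exists p.
have yU : nbhs y [set v | N (v - y) < e].
  apply/nbhs_ballP; exists (e / C); first by rewrite /= divr_gt0.
  move=> v; rewrite -ball_normE /ball_/= => yv.
  by rewrite (le_lt_trans (NC _))// mulrC -ltr_pdivlMr// distrC.
by have [_ [[p Pp ->] h]] := cy _ _ uP yU; exists p.
Qed.

Lemma countable_dense_in (E : set V) : E !=set0 ->
  exists e : 'rV[rat]_m * nat -> V, (forall i, E (e i)) /\
    forall y d, E y -> 0 < d -> exists i, N (e i - y) <= d.
Proof.
move=> [y0 Ey0]; have [C C0 NC] := is_norm_le_sup hN.
pose near (i : 'rV[rat]_m * nat) :=
  [set y | E y /\ N (y - map_mx ratr i.1) <= i.2.+1%:R^-1].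
pose e i := if pselect (near i !=set0) is left h then projT1 (cid h) else y0.
exists e; split=> [i|y d Ey d0].
  by rewrite /e; case: pselect => // h; case: cid => v [].
have [l ld] : exists l : nat, l.+1%:R^-1 <= d / 2.
  exists (Num.truncn (d / 2)^-1); rewrite invf_ple ?posrE ?divr_gt0//.
  exact/ltW/Num.Theory.truncnS_gt.
have q0 : 0 < l.+1%:R^-1 / C by rewrite divr_gt0// invr_gt0.
have [q yq] := rat_dense_row y q0.
have Nyq : N (y - map_mx ratr q) <= l.+1%:R^-1.
  by rewrite (le_trans (NC _))// mulrC -ler_pdivlMr.
exists (q, l); rewrite /e; case: pselect => [h|[]]; last by exists y.
case: cid => v [_ vq] /=.
apply: (le_trans (is_norm_triangle hN v (map_mx ratr q) y)).
rewrite (splitr d) lerD//; first exact: le_trans ld.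
by rewrite (is_normBC hN) (le_trans Nyq).
Qed.

Variables (d : measure_display) (W : measurableType d) (I : countType).
Variables (c0 : W -> V) (c : I -> W -> V) (r : R).
Hypothesis mc0 : measurable_fun setT c0.
Hypothesis mc : forall i, measurable_fun setT (c i).

Lemma measurable_dist (y : V) (f : W -> V) : measurable_fun setT f ->
  measurable_fun setT (fun w => N (y - f w) : measurableTypeR R).
Proof.
move=> mf; apply: (measurableT_comp (measurable_is_norm hN)).
by apply: measurable_row_add; [exact: measurable_cst|exact: measurable_row_opp].
Qed.

Lemma measurable_dist_le (y : V) (f : W -> V) a : measurable_fun setT f ->
  measurable [set w | N (y - f w) <= a].
Proof.
move=> mf.
have := measurable_dist y mf measurableT (measurable_itv `]-oo, a]); rewrite setTI.
by congr measurable; apply/seteqP; split => w; rewrite /= in_itv.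
Qed.

Lemma measurable_dist_lt (y : V) (f : W -> V) a : measurable_fun setT f ->
  measurable [set w | N (y - f w) < a].
Proof.
move=> mf.
have := measurable_dist y mf measurableT (measurable_itv `]-oo, a[); rewrite setTI.
by congr measurable; apply/seteqP; split => w; rewrite /= in_itv.
Qed.

Lemma measurable_dist_ge (y : V) (f : W -> V) a : measurable_fun setT f ->
  measurable [set w | a <= N (y - f w)].
Proof.
move=> mf; rewrite (_ : [set w | _] = ~` [set w | N (y - f w) < a]).
  exact/measurableC/measurable_dist_lt.
by apply/seteqP; split => w /=; [rewrite leNgt => /negP|move=> /negP; rewrite -leNgt].
Qed.

Let closed_case (E : set V) (rho : R) : metric_closed (fun x y => N (x - y)) E ->
  measurable [set w | exists y, [/\ E y, N (y - c0 w) <= rho &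
    forall i, r <= N (y - c i w)]].
Proof.
move=> cE; have [E0|/set0P E0] := eqVneq E set0.
  rewrite (_ : [set w | _] = set0)//; apply/seteqP; split => // w [y []].
  by rewrite E0.
have [e [eE edense]] := countable_dense_in E0.
pose h p := p.+1%:R^-1 : R.
have h0 p : 0 < h p by rewrite /h invr_gt0.
rewrite (_ : [set w | _] = [set w | forall p, exists j,
    N (e j - c0 w) <= rho + h p /\ forall i, r - h p <= N (e j - c i w)]).
  apply: measurable_forall => p; apply: measurable_exists => j.
  apply: measurableI; first exact: measurable_dist_le.
  by apply: measurable_forall => i; exact: measurable_dist_ge.
apply/seteqP; split => w /=.
  move=> [y [Ey y0 yi]] p; have [j ej] := edense y (h p) Ey (h0 p); exists j; split.
    by have := is_norm_triangle hN (e j) y (c0 w); lra.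
  by move=> i; have := is_norm_triangle hN y (e j) (c i w); have := yi i;
    rewrite (is_normBC hN y (e j)); lra.
move=> /choice[f hf].
have bu p : N (e (f p)) <= rho + 1 + N (c0 w).
  have [+ _] := hf p; have : h p <= 1 by rewrite /h invf_le1// ler1n.
  by have := is_norm_triangle hN (e (f p)) (c0 w) 0; rewrite !subr0; lra.
have [y hy] := is_norm_cluster bu.
have near_y eps : 0 < eps -> exists p, N (e (f p) - y) < eps /\ h p < eps.
  move=> e0; have [p Pp yp] := hy _ e0 (Num.truncn eps^-1); exists p; split=> //.
  rewrite /h invf_plt ?posrE// (lt_le_trans (Num.Theory.truncnS_gt _))//.
  by rewrite ler_nat ltnS.
exists y; split.
- apply: cE => eps e0; have [p [yp _]] := near_y _ e0.
  by exists (e (f p)) => //; rewrite (is_normBC hN).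
- apply/ler_addgt0Pr => eps e0.
  have [p [yp hp]] := near_y (eps / 2) (divr_gt0 e0 (ltr0Sn _ 1)).
  have [h1 _] := hf p; have := is_norm_triangle hN y (e (f p)) (c0 w).
  by rewrite (is_normBC hN y (e (f p))); lra.
- move=> i; apply/ler_addgt0Pr => eps e0.
  have [p [yp hp]] := near_y (eps / 2) (divr_gt0 e0 (ltr0Sn _ 1)).
  have [_ /(_ i) h1] := hf p; have := is_norm_triangle hN (e (f p)) y (c i w).
  by lra.
Qed.

(** The witness y ranges over an uncountable set. The strict inequality is a
    countable union of closed conditions N (y - c0) <= r - 1/p; for closed
    conditions, compactness shows that a witness exists if and only if
    approximate witnesses with arbitrarily small error exist in a fixed
    countable dense subset of E. *)
Lemma measurable_hitting (E : set V) : metric_closed (fun x y => N (x - y)) E ->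
  measurable [set w | exists y, [/\ E y, N (y - c0 w) < r &
    forall i, r <= N (y - c i w)]].
Proof.
move=> cE; rewrite (_ : [set w | _] = [set w | exists p : nat, exists y,
  [/\ E y, N (y - c0 w) <= r - p.+1%:R^-1 & forall i, r <= N (y - c i w)]]).
  by apply: measurable_exists => p; exact: closed_case.
apply/seteqP; split => w /=; last first.
  move=> [p [y [Ey y0 yi]]]; exists y; split=> //; apply: (le_lt_trans y0).
  by rewrite ltrBlDr ltrDl invr_gt0.
move=> [y [Ey y0 yi]]; exists (Num.truncn (r - N (y - c0 w))^-1), y; split=> //.
rewrite lerBrDr -lerBrDl invf_ple ?posrE ?subr_gt0//.
exact/ltW/Num.Theory.truncnS_gt.
Qed.

End hitting_events.

(** * Periodic sets *)

Section countable_families.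
Context d (T : measurableType d) (R : realType) (I : countType).
Implicit Types (mu : {measure set T -> \bar R}) (F : I -> set T).

(** Turns a family indexed by a countable type into a sequence, with empty sets
    at the codes of no index. *)
Definition on_code (F : I -> set T) (k : nat) : set T :=
  if @pickle_inv I k is Some i then F i else set0.

Lemma bigcup_on_code F : \bigcup_k on_code F k = [set x | exists i, F i x].
Proof.
apply/seteqP; split => x.
  by move=> [k _]; rewrite /on_code; case: pickle_inv => // i Fx; exists i.
by move=> [i Fx]; exists (pickle i) => //; rewrite /on_code pickleK_inv.
Qed.

Lemma measurable_on_code F k : (forall i, measurable (F i)) -> measurable (on_code F k).
Proof. by move=> mF; rewrite /on_code; case: pickle_inv. Qed.

Lemma trivIset_on_code F : (forall i j x, F i x -> F j x -> i = j) ->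
  trivIset setT (on_code F).
Proof.
move=> tF k l _ _ [x []]; rewrite /on_code.
have := @pickle_invK I k; have := @pickle_invK I l.
case: (pickle_inv l) => [j|//] /= <-; case: (pickle_inv k) => [i|//] /= <- Fi Fj.
by rewrite (tF _ _ _ Fi Fj).
Qed.

Lemma null_exists mu F : (forall i, measurable (F i)) -> (forall i, mu (F i) = 0%E) ->
  mu [set x | exists i, F i x] = 0%E.
Proof.
move=> mF F0; rewrite -bigcup_on_code; apply/eqP; rewrite eq_le measure_ge0 andbT.
apply: (le_trans (measure_sigma_subadditive _ (F := on_code F) _ _ _)) => //.
- by move=> k; exact: measurable_on_code.
- by apply: bigcupT_measurable => k; exact: measurable_on_code.
- rewrite eseries0// => k _ _; rewrite /on_code.
  by case: pickle_inv => [i|]; rewrite ?F0 ?measure0.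
Qed.

End countable_families.

Section lattice_periodic.
Variables (R : realType) (m : nat).
Local Notation V := 'rV[R]_m.

Definition lattice_point (z : 'rV[int]_m) : V := map_mx intr z.

Lemma unit_cell_floor (u : V) : unit_cell (u - lattice_point (map_mx Num.floor u)).
Proof.
move=> i; rewrite /= in_itv/= !mxE subr_ge0 ltrBlDr addrC.
by have := Num.Theory.floor_itv (u ord0 i); rewrite intrD addrC.
Qed.

Lemma unit_cell_uniq (u : V) z z' : unit_cell (u - lattice_point z) ->
  unit_cell (u - lattice_point z') -> z = z'.
Proof.
move=> hz hz'; apply/rowP => i; have := hz i; have := hz' i.
rewrite /= !in_itv/= !mxE => /andP[a b] /andP[a' b'].
have h1 : (z ord0 i)%:~R < (z' ord0 i + 1)%:~R :> R by rewrite intrD; lra.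
have h2 : (z' ord0 i)%:~R < (z ord0 i + 1)%:~R :> R by rewrite intrD; lra.
by apply/eqP; move: h1 h2; rewrite !ltr_int !ltzD1 eq_le => -> ->.
Qed.

Variables (A : set V) (L : R).
Hypotheses (mA : measurable A) (L0 : 0 < L).

Let B := [set u : V | A (L *: u)].
Let mB : measurable B.
Proof. exact: measurable_preim (measurable_row_scale L) mA. Qed.

Let F z := [set v : V | B (v + lattice_point z) /\ unit_cell v].
Let mF z : measurable (F z).
Proof.
apply: measurableI; last exact: measurable_unit_cell.
exact: measurable_preim (measurable_row_shift _) mB.
Qed.

Let S z := [set u : V | B u /\ unit_cell (u - lattice_point z)].
Let mS z : measurable (S z).
Proof.
apply: measurableI => //.
exact: measurable_preim (measurable_row_shift _) (@measurable_unit_cell R m).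
Qed.

Let vol_FS z : vol (F z) = vol (S z).
Proof.
rewrite -(vol_shift (lattice_point z) (mS z)); congr vol.
by apply/seteqP; split => v; rewrite /F/S/= addrK.
Qed.

Let vol_B : (vol B = (L ^+ m)^-1%:E * vol A)%E.
Proof. exact: vol_scale. Qed.

Let sum_F : (vol B = \sum_(k <oo) vol (on_code F k))%E.
Proof.
have -> : B = \bigcup_k on_code S k.
  rewrite bigcup_on_code; apply/seteqP; split => u; last by case=> z [].
  by move=> Bu; exists (map_mx Num.floor u); split => //; exact: unit_cell_floor.
have E k : vol (on_code F k) = vol (on_code S k).
  by rewrite /on_code; case: pickle_inv => [z|]; [exact: vol_FS|].
under [RHS]eq_eseriesr do rewrite E.
apply: measure_semi_bigcup.
- by move=> k; exact: measurable_on_code.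
- by apply: trivIset_on_code => z z' u [_ h] [_ h']; exact: unit_cell_uniq h h'.
- by apply: bigcupT_measurable => k; exact: measurable_on_code.
Qed.

Definition periodic_hit := [set v : V | exists z, A (L *: (v + lattice_point z))].

Lemma measurable_periodic_hit : measurable periodic_hit.
Proof.
by apply: measurable_exists => z; exact: measurable_preim (measurable_row_shift _) mB.
Qed.

Let cell_hitE : cell_vol periodic_hit = vol (\bigcup_k on_code F k).
Proof.
rewrite bigcup_on_code; congr vol; apply/seteqP; split => v.
  by move=> [[z Az] cv]; exists z.
by move=> [z [Az cv]]; split => //; exists z.
Qed.

(** The translates of the unit cell tile the space; cut A along the tiling and
    translate the pieces back to the cell, where they may overlap. *)
Lemma cell_vol_hit_le : (cell_vol periodic_hit <= (L ^+ m)^-1%:E * vol A)%E.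
Proof.
rewrite cell_hitE -vol_B sum_F; apply: measure_sigma_subadditive => //.
- by move=> k; exact: measurable_on_code.
- by apply: bigcupT_measurable => k; exact: measurable_on_code.
Qed.

(** No volume is lost when the pieces do not overlap. *)
Lemma cell_vol_hit_eq :
  (forall v z z', A (L *: (v + lattice_point z)) ->
    A (L *: (v + lattice_point z')) -> z = z') ->
  (cell_vol periodic_hit = (L ^+ m)^-1%:E * vol A)%E.
Proof.
move=> uA; rewrite cell_hitE -vol_B sum_F measure_semi_bigcup//.
- by move=> k; exact: measurable_on_code.
- by apply: trivIset_on_code => z z' u [h _] [h' _]; exact: uA h h'.
- by apply: bigcupT_measurable => k; exact: measurable_on_code.
Qed.

End lattice_periodic.

(** * The random ball partition *)

Section ball_partition.
Variables (R : realType) (m : nat) (N : 'rV[R]_m -> R) (r L : R).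
Hypotheses (hN : is_norm N) (r0 : 0 < r) (L0 : 0 < L).
Hypothesis lattice_sep :
  forall z : 'rV[int]_m, z != 0 -> 2 * r <= N (L *: lattice_point R z).
Local Notation V := 'rV[R]_m.
Local Notation mR := (measurableTypeR R).
Local Notation unif := (@unif R).

(** The seed of the draws that follow the first one. *)
Definition shift_bits (w : mR) : mR := (split_vector m w).2.

Definition center (k : nat) (z : 'rV[int]_m) (w : mR) : V :=
  L *: ((split_vector m (iter k shift_bits w)).1 + lattice_point R z).

(** Balls are open, so that the constraints coming from the infinitely many
    earlier balls are closed, as [measurable_hitting] requires. *)
Definition region (k : nat) (z : 'rV[int]_m) (w : mR) : set V :=
  [set y | N (y - center k z w) < r /\
    forall jz : 'I_k * 'rV[int]_m, r <= N (y - center jz.1 jz.2 w)].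

Lemma measurable_shift_bits : measurable_fun setT shift_bits.
Proof. by apply: (measurableT_comp measurable_snd); exact: measurable_split_vector. Qed.

Lemma centerS k z w : center k.+1 z w = center k z (shift_bits w).
Proof. by rewrite /center iterSr. Qed.

Lemma measurable_center k z : measurable_fun setT (center k z).
Proof.
elim: k => [|k ih]; last first.
  rewrite (_ : center k.+1 z = center k z \o shift_bits).
    by apply: (measurableT_comp ih); exact: measurable_shift_bits.
  by apply/funext => w; rewrite centerS.
have m1 : measurable_fun setT (fun w : mR => (split_vector m w).1).
  by apply: (measurableT_comp measurable_fst); exact: measurable_split_vector.
apply: (measurableT_comp (measurable_row_scale L)).
by apply: measurable_row_add => //; exact: measurable_cst.
Qed.

Lemma measurable_region_hits k z (E : set V) : metric_closed (fun x y => N (x - y)) E ->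
  measurable [set w | E `&` region k z w !=set0].
Proof.
move=> cE.
have := measurable_hitting hN r (measurable_center k z)
  (fun jz : 'I_k * 'rV[int]_m => measurable_center jz.1 jz.2) cE.
congr measurable; apply/seteqP; split => w /=.
  by move=> [y [Ey y0 yi]]; exists y; split.
by move=> [y [Ey [y0 yi]]]; exists y; split.
Qed.

Lemma measurable_region k z y : measurable [set w | region k z w y].
Proof.
apply: measurableI; first exact: measurable_dist_lt (measurable_center k z).
by apply: measurable_forall => jz; exact: measurable_dist_ge (measurable_center _ _).
Qed.

Lemma center_uniq k w y z z' :
  N (y - center k z w) < r -> N (y - center k z' w) < r -> z = z'.
Proof.
move=> h h'; apply/eqP; rewrite -subr_eq0; apply/negP => /negP/lattice_sep.
have -> : L *: lattice_point R (z - z') = center k z w - center k z' w.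
  rewrite -scalerBr; congr (_ *: _); rewrite opprD addrACA subrr add0r.
  by apply/rowP => i; rewrite !mxE intrB.
rewrite leNgt => /negP; apply.
apply: (le_lt_trans (is_norm_triangle hN _ y _)).
by rewrite (is_normBC hN (center k z w)); lra.
Qed.

Lemma region_uniq k z k' z' w y : region k z w y -> region k' z' w y -> (k, z) = (k', z').
Proof.
move=> [yk hk] [yk' hk'].
have kk' : k = k'.
  have [lt|lt|//] := ltngtP k k'.
    by have := hk' (Ordinal lt, z); rewrite leNgt yk.
  by have := hk (Ordinal lt, z'); rewrite leNgt yk'.
by move: yk' hk'; rewrite -kk' => yk' _; rewrite (center_uniq yk yk').
Qed.

Lemma region_exists w y : (exists k z, N (y - center k z w) < r) ->
  exists k z, region k z w y.
Proof.
move=> [k0 [z0 h0]].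
have P0 : exists k, `[< exists z, N (y - center k z w) < r >].
  by exists k0; apply/asboolP; exists z0.
case: (ex_minnP P0) => k /asboolP[z kz] kmin; exists k, z; split=> // -[j z'] /=.
rewrite leNgt; apply/negP => h; have : `[< exists z, N (y - center j z w) < r >].
  by apply/asboolP; exists z'.
by move/kmin; rewrite leqNgt ltn_ord.
Qed.

Lemma region_diam k z w x y : region k z w x -> region k z w y -> N (x - y) <= 2 * r.
Proof.
move=> [hx _] [hy _]; apply: (le_trans (is_norm_triangle hN _ (center k z w) _)).
by rewrite (is_normBC hN (center k z w)); lra.
Qed.

Definition cell_hit (A : set V) : set V := periodic_hit A L.

Lemma cell_hit_ball y w rho : cell_hit (open_ball N y rho) (split_vector m w).1 <->
  exists z, N (y - center 0 z w) < rho.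
Proof.
split=> -[z h]; exists z; first by rewrite (is_normBC hN).
by move: h; rewrite (is_normBC hN).
Qed.

Lemma cell_vol_hit_ball y rho : rho <= r ->
  (cell_vol (cell_hit (open_ball N y rho)) = (L ^+ m)^-1%:E * vol (open_ball N y rho))%E.
Proof.
move=> rhor; apply: cell_vol_hit_eq => //; first exact: measurable_open_ball.
move=> v z z' /=; rewrite /open_ball/= => h h'.
apply/eqP; rewrite -subr_eq0; apply/negP => /negP/lattice_sep.
have -> : L *: lattice_point R (z - z') =
    L *: (v + lattice_point R z) - L *: (v + lattice_point R z').
  rewrite -scalerBr; congr (_ *: _); rewrite opprD addrACA subrr add0r.
  by apply/rowP => i; rewrite !mxE intrB.
rewrite leNgt => /negP; apply.
apply: (le_lt_trans (is_norm_triangle hN _ y _)).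
by rewrite (is_normBC hN y); lra.
Qed.

Lemma measurable_cell_hit A : measurable A -> measurable (cell_hit A).
Proof. by move=> mA; exact: measurable_periodic_hit. Qed.

Lemma vol_open_ball_shift y rho : vol (open_ball N y rho) = vol (open_ball N 0 rho).
Proof.
rewrite -(vol_shift y (measurable_open_ball hN y rho)); congr vol.
by apply/seteqP; split => v; rewrite /open_ball/= addrK subr0.
Qed.

Lemma unif_fin A : measurable A -> unif A = (fine (unif A))%:E.
Proof. by move=> mA; rewrite fineK// fin_num_measure. Qed.

Lemma cell_vol_fin (A : set V) : measurable A -> cell_vol A = (fine (cell_vol A))%:E.
Proof. by move=> mA; rewrite fineK// fin_num_measure. Qed.

(** Conditioning on the first draw: P(E) <= P(D) + (1 - P(H)) P(E), since the
    remaining draws are independent of it and distributed as the whole sequence.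
    *)
Lemma renewal_bound (E : set mR) (H D : set V) : measurable E -> measurable H ->
  measurable D ->
  (forall w, E w -> D (split_vector m w).1 \/
     (~ H (split_vector m w).1 /\ E (shift_bits w))) ->
  (cell_vol H * unif E <= cell_vol D)%E.
Proof.
move=> mE mH mD step.
have mHc : measurable (~` H) by exact: measurableC.
have m1 (A : set V) : measurable A -> measurable [set w | A (split_vector m w).1].
  move=> mA; apply: measurable_preim mA.
  by apply: (measurableT_comp measurable_fst); exact: measurable_split_vector.
have m2 : measurable [set w | E (shift_bits w)].
  exact: measurable_preim measurable_shift_bits mE.
have uD : unif [set w | D (split_vector m w).1] = cell_vol D.
  have := unif_split_vector mD (@measurableT _ mR); rewrite probability_setT mule1 => <-.
  by congr unif; apply/seteqP; split => w // -[].
pose A1 := [set w | D (split_vector m w).1].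
pose A2 := [set w | (~` H) (split_vector m w).1 /\ E (split_vector m w).2].
have mA1 : measurable A1 by exact: m1.
have mA2 : measurable A2 by apply: measurableI => //; exact: m1.
have uE : (unif E <= cell_vol D + cell_vol (~` H) * unif E)%E.
  rewrite -(unif_split_vector mHc mE) -uD.
  apply: (@le_trans _ _ (unif (A1 `|` A2))); last exact: measureU2.
  apply: le_measure; rewrite ?inE//; first exact: measurableU.
have e : (cell_vol (~` H) = (1 - fine (cell_vol H))%:E)%E.
  by rewrite (probability_setC (@cell_vol R m) mH) EFinB -cell_vol_fin.
move: uE; rewrite e (unif_fin mE) (cell_vol_fin mD) [cell_vol H](cell_vol_fin mH).
rewrite -!EFinM -EFinD !lee_fin mulrBl mul1r => uE.
lra.
Qed.

Definition separated (x y : V) : set mR :=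
  [set w | exists kz : nat * 'rV[int]_m, region kz.1 kz.2 w x /\ ~ region kz.1 kz.2 w y].

Lemma measurable_separated x y : measurable (separated x y).
Proof.
apply: measurable_exists => kz; apply: measurableI; first exact: measurable_region.
by apply: measurableC; exact: measurable_region.
Qed.

Let no_earlier (P : 'I_0 * 'rV[int]_m -> Prop) jz : P jz.
Proof. by case: jz => -[]. Qed.

Lemma region0 z w y : N (y - center 0 z w) < r -> region 0 z w y.
Proof.
move=> h; split=> // jz.
exact: (no_earlier (fun jz => r <= N (y - center jz.1 jz.2 w))).
Qed.

(** If the first draw misses y, the clusters of y are those of the remaining
    draws, renumbered. *)
Lemma region_shift k z w y : ~ cell_hit (open_ball N y r) (split_vector m w).1 ->
  region k z (shift_bits w) y <-> region k.+1 z w y.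
Proof.
move=> nh; rewrite /region/= centerS; split=> -[h hj]; split=> // -[j z'] /=.
  case: (unliftP ord0 j) => [j'|] ->.
    by rewrite /= /bump/= add1n centerS; exact: (hj (j', z')).
  by rewrite leNgt; apply/negP => hy; apply: nh; apply/cell_hit_ball; exists z'.
have := hj (lift ord0 j, z'); rewrite /= /bump/= add1n centerS.
by [].
Qed.

(** One step of the renewal argument: a first draw that puts x and y in the same
    ball never separates them. *)
Lemma separated_step x y w : separated x y w ->
  (cell_hit (open_ball N x r `\` open_ball N y r) `|`
   cell_hit (open_ball N y r `\` open_ball N x r)) (split_vector m w).1 \/
  (~ (cell_hit (open_ball N x r) `|` cell_hit (open_ball N y r)) (split_vector m w).1 /\
   separated x y (shift_bits w)).
Proof.
move=> [[k z] /= [hx nhy]].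
have both z0 : N (x - center 0 z0 w) < r -> N (y - center 0 z0 w) < r -> False.
  move=> /region0 x0 /region0 y0; apply: nhy.
  by have [-> ->] := region_uniq hx x0.
have [hitx|nhx] := pselect (cell_hit (open_ball N x r) (split_vector m w).1).
  left; left; have [z0 x0] := hitx; exists z0; split => // y0.
  by apply: (both z0); rewrite (is_normBC hN).
have [hity|nhity] := pselect (cell_hit (open_ball N y r) (split_vector m w).1).
  left; right; have [z0 y0] := hity; exists z0; split => // x0.
  by apply: (both z0); rewrite (is_normBC hN).
right; split; first by case.
case: k hx nhy {both} => [|k] hx nhy.
  by case: nhx; apply/cell_hit_ball; exists z; case: hx.
exists (k, z); split; first exact/region_shift.
by move=> /region_shift; apply: contra_not nhy; apply.
Qed.

Lemma unif_separated x y :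
  (vol (open_ball N 0 r) * unif (separated x y) <=
   vol (open_ball N x r `\` open_ball N y r) + vol (open_ball N y r `\` open_ball N x r))%E.
Proof.
have mB u : measurable (open_ball N u r) by exact: measurable_open_ball.
have mBB u v : measurable (open_ball N u r `\` open_ball N v r) by exact: measurableD.
have mh A : measurable A -> measurable (cell_hit A) by exact: measurable_cell_hit.
set D := (vol _ + vol _)%E.
have c0 : 0 < (L ^+ m)^-1 by rewrite invr_gt0 exprn_gt0.
rewrite -(@lee_pmul2l _ (L ^+ m)^-1%:E)//.
rewrite muleA.
have := renewal_bound (measurable_separated x y)
  (measurableU _ _ (mh _ (mB x)) (mh _ (mB y)))
  (measurableU _ _ (mh _ (mBB x y)) (mh _ (mBB y x))) (@separated_step x y).
move=> h; apply: (le_trans _ (le_trans h _)).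
  rewrite -(vol_open_ball_shift x) -cell_vol_hit_ball//.
  apply: lee_wpmul2r => //; apply: le_measure; rewrite ?inE; [exact: mh| |].
    by apply: measurableU; exact: mh.
  by left.
apply: (le_trans (measureU2 _ (mh _ (mBB x y)) (mh _ (mBB y x)))).
rewrite /D muleDr//; last by apply: ge0_adde_def; rewrite inE.
by apply: leeD; apply: cell_vol_hit_le.
Qed.

(** The renewal bound with D empty. *)
Lemma unif_never_hit y rho : 0 < rho -> rho <= r ->
  unif [set w | ~ exists kz : nat * 'rV[int]_m, N (y - center kz.1 kz.2 w) < rho] = 0%E.
Proof.
move=> rho0 rhor; set E := [set w | _].
have mE : measurable E.
  rewrite (_ : E = ~` [set w | exists kz : nat * 'rV[int]_m,
    N (y - center kz.1 kz.2 w) < rho])//.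
  apply: measurableC; apply: measurable_exists => kz.
  exact: measurable_dist_lt (measurable_center _ _).
have mB : measurable (open_ball N y rho) by exact: measurable_open_ball.
have := @renewal_bound E (cell_hit (open_ball N y rho)) set0 mE
  (measurable_cell_hit mB) measurable0.
have step w : E w -> set0 (split_vector m w).1 \/
  ~ cell_hit (open_ball N y rho) (split_vector m w).1 /\ E (shift_bits w).
  move=> nw; right; split.
    by move=> /cell_hit_ball[z h]; apply: nw; exists (0%N, z).
  by move=> [[k z] /= h]; apply: nw; exists (k.+1, z); rewrite /= centerS.
move=> /(_ step); rewrite measure0 cell_vol_hit_ball// vol_open_ball_shift => h.
apply/eqP; rewrite eq_le measure_ge0 andbT.
have p0 : (0 < (L ^+ m)^-1%:E * vol (open_ball N 0 rho))%E.
  by rewrite mule_gt0 ?lte_fin ?invr_gt0 ?exprn_gt0// vol_open_ball_gt0.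
by move: h; rewrite pmule_rle0.
Qed.

(** It suffices to cover rational points by balls of radius r / 2, a countable
    condition, for the balls of radius r to cover everything. *)
Definition covered : set mR :=
  [set w | forall q : 'rV[rat]_m, exists kz : nat * 'rV[int]_m,
    N (map_mx ratr q - center kz.1 kz.2 w) < r / 2].

Lemma measurable_covered : measurable covered.
Proof.
apply: measurable_forall => q; apply: measurable_exists => kz.
exact: measurable_dist_lt (measurable_center _ _).
Qed.

Lemma unif_not_covered : unif (~` covered) = 0%E.
Proof.
rewrite (_ : ~` covered = [set w | exists q : 'rV[rat]_m,
    [set w | ~ exists kz : nat * 'rV[int]_m,
    N (map_mx ratr q - center kz.1 kz.2 w) < r / 2] w]); last first.
  by apply/seteqP; split => w /=; [move/existsNP|move=> h; apply/existsNP].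
apply: null_exists => q; last first.
  by apply: unif_never_hit; [rewrite divr_gt0|rewrite ler_pdivrMr// ler_pMr// ler1n].
apply: measurableC; apply: measurable_exists => kz.
exact: measurable_dist_lt (measurable_center _ _).
Qed.

Lemma covered_region w y : covered w -> exists k z, region k z w y.
Proof.
move=> cw; have [C C0 NC] := is_norm_le_sup hN.
have d0 : 0 < r / 2 / C by rewrite !divr_gt0.
have [q yq] := rat_dense_row y d0; have [[k z] /= h] := cw q.
apply: region_exists; exists k, z.
apply: (le_lt_trans (is_norm_triangle hN _ (map_mx ratr q) _)).
have : N (y - map_mx ratr q) <= r / 2.
  by rewrite (le_trans (NC _))// mulrC -ler_pdivlMr.
lra.
Qed.

Lemma exists_covered : exists w, covered w.
Proof.
apply: contrapT => /forallNP h; have := unif_not_covered.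
rewrite (_ : ~` covered = setT); last by apply/seteqP; split => // w _; exact: h.
by rewrite probability_setT => /eqP; rewrite onee_eq0.
Qed.

Definition covered_seed : mR := projT1 (cid exists_covered).

(** A partition is required for every outcome: on the null set of seeds whose
    balls leave a point uncovered, use one fixed good seed instead. *)
Definition resample (w : mR) : mR := if `[< covered w >] then w else covered_seed.

Lemma covered_resample w : covered (resample w).
Proof.
by rewrite /resample; case: asboolP => // _; rewrite /covered_seed; case: cid.
Qed.

Lemma measurable_resample (A : set mR) :
  measurable A -> measurable [set w | A (resample w)].
Proof.
move=> mA; rewrite (_ : [set w | _] = (A `&` covered) `|`
    ([set _ | A covered_seed] `&` ~` covered)).
  apply: measurableU; first by apply: measurableI => //; exact: measurable_covered.
  apply: measurableI; last by apply: measurableC; exact: measurable_covered.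
  have [As|nAs] := pselect (A covered_seed).
    by rewrite (_ : [set _ | _] = setT)//; apply/seteqP; split.
  by rewrite (_ : [set _ | _] = set0)//; apply/seteqP; split.
rewrite /resample; apply/seteqP; split => w /=.
  by case: asboolP => cw Aw; [left|right].
by case=> -[Aw cw]; case: asboolP.
Qed.

(** Clusters are numbered through the code of the pair (draw, lattice
    translate). *)
Definition cluster_index (i : nat) (w : mR) : set V :=
  if @pickle_inv (nat * 'rV[int]_m)%type i is Some kz
  then region kz.1 kz.2 (resample w) else set0.

Let cluster_index_cover w : \bigcup_k cluster_index k w = setT.
Proof.
apply/seteqP; split => // y _.
have [k [z h]] := covered_region y (covered_resample w).
by exists (pickle (k, z)) => //; rewrite /cluster_index pickleK_inv.
Qed.

Let cluster_index_disjoint w : trivIset setT (fun k => cluster_index k w).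
Proof.
apply: (@trivIset_on_code _ V (nat * 'rV[int]_m)%type
  (fun kz => region kz.1 kz.2 (resample w))).
by move=> [k z] [k' z'] y; exact: region_uniq.
Qed.

Let cluster_index_measurable k (E : set V) : metric_closed (fun x y => N (x - y)) E ->
  measurable [set w | E `&` cluster_index k w !=set0].
Proof.
move=> cE; rewrite /cluster_index; case: pickle_inv => [[j z]|].
  by have := measurable_resample (measurable_region_hits j z cE).
by rewrite (_ : [set w | _] = set0)//; apply/seteqP; split => // w [y []].
Qed.

Definition ball_partition : random_partition (fun x y : V => N (x - y)) :=
  @RandomPartition R V _ _ mR unif cluster_index cluster_index_cover cluster_index_disjoint
    cluster_index_measurable.

Lemma ball_partition_bounded : bounded_partition (2 * r) ball_partition.
Proof.
move=> w i; apply: ge_ereal_sup => _ [[x y] [/= hx hy] <-]; rewrite lee_fin.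
move: hx hy; rewrite /cluster_index; case: pickle_inv => // -[k z].
exact: region_diam.
Qed.

Lemma cluster_at_separated x y :
  [set w | cluster_at (P := ball_partition) w x <> cluster_at (P := ball_partition) w y] =
  [set w | separated x y (resample w)].
Proof.
have uniq w i j u : cluster_index i w u -> cluster_index j w u -> i = j.
  by move=> hi hj; apply: (cluster_index_disjoint (w := w)) => //; exists u.
apply/seteqP; split => w /=.
  move=> ne; apply: contrapT => ns; apply: ne.
  have [k [z kx]] := covered_region x (covered_resample w).
  have ky : region k z (resample w) y.
    by apply: contrapT => nky; apply: ns; exists (k, z).
  have E u : region k z (resample w) u ->
      cluster_at (P := ball_partition) w u = cluster_index (pickle (k, z)) w.
    move=> ku; have hu : cluster_index (pickle (k, z)) w u.
      by rewrite /cluster_index pickleK_inv.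
    apply/seteqP; split => v; last by move=> hv; exists (pickle (k, z)).
    by move=> [i /= hi]; rewrite (uniq _ _ _ _ hi hu).
  by rewrite !E.
move=> [[k z] /= [kx nky]] e.
have hx : cluster_index (pickle (k, z)) w x by rewrite /cluster_index pickleK_inv.
have : cluster_at (P := ball_partition) w y y.
  have : (\bigcup_i cluster_index i w) y by rewrite cluster_index_cover.
  by move=> [i _ hi]; exists i.
rewrite -e => -[i /= hi hiy]; apply: nky.
by move: hiy; rewrite (uniq _ _ _ _ hi hx) /cluster_index pickleK_inv.
Qed.

Lemma ball_partition_separation x y :
  (vol (open_ball N 0 r) * rp_prob ball_partition [set w |
     cluster_at (P := ball_partition) w x <> cluster_at (P := ball_partition) w y] <=
   vol (open_ball N x r `\` open_ball N y r) + vol (open_ball N y r `\` open_ball N x r))%E.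
Proof.
apply: le_trans (unif_separated x y); apply: lee_wpmul2l => //.
rewrite cluster_at_separated.
have mS := measurable_separated x y.
have mC : measurable (~` covered) by apply: measurableC; exact: measurable_covered.
apply: (@le_trans _ _ (unif (separated x y `|` ~` covered))).
  apply: le_measure; rewrite ?inE; [exact: measurable_resample|exact: measurableU|].
  by move=> w /=; rewrite /resample; case: asboolP => cw; [left|right].
by rewrite -[leRHS]adde0 -unif_not_covered; exact: measureU2.
Qed.

End ball_partition.

(** * The separation profile *)

Section profile.
Variables (R : realType) (n : nat) (N : 'rV[R]_n.+1 -> R).
Hypothesis hN : is_norm N.
Local Notation V := 'rV[R]_n.+1.
Local Notation pN := (polar_projection_norm N).
Local Notation ballvol := (fine (vol (unit_ball N))).

(** A nonzero integer vector has sup norm at least 1, so a large multiple of it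
    is long for N. *)
Lemma exists_lattice_scale (r : R) : 0 < r -> exists2 L : R, 0 < L &
  forall z : 'rV[int]_n.+1, z != 0 -> 2 * r <= N (L *: lattice_point R z).
Proof.
move=> r0; have [c c0 cN] := is_norm_ge_sup hN.
have L0 : 0 < 2 * r / c by rewrite divr_gt0// mulr_gt0.
exists (2 * r / c) => // z z0; apply: le_trans (cN _).
rewrite normrZ gtr0_norm// mulrA [c * _]mulrC divfK ?gt_eqF//.
rewrite ler_pMr ?mulr_gt0//.
have [i zi] : exists i, z ord0 i != 0.
  by apply/existsP; apply: contra_neqT z0 => /existsPn h; apply/rowP => i;
    rewrite mxE; apply/eqP; have := h i; rewrite negbK.
apply: le_trans (coord_le_norm _ i); rewrite mxE -intr_norm ler1z.
by rewrite -gtz0_ge1 normr_gt0.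
Qed.

Lemma ballvol_gt0 : 0 < ballvol.
Proof.
apply: fine_gt0; rewrite (vol_unit_ball hN).
by rewrite vol_open_ball_gt0// vol_open_ball_ltoo.
Qed.

Lemma vol_open_ball_scale (r : R) : 0 < r ->
  vol (open_ball N 0 r) = (r ^+ n.+1 * ballvol)%:E.
Proof.
move=> r0.
have e : [set v | open_ball N 0 r (r *: v)] = open_ball N 0 1.
  apply/seteqP; split => v; rewrite /open_ball/= !subr0 (is_normZ hN) gtr0_norm//;
    by rewrite -ltr_pdivlMl// mulVf ?gt_eqF.
have := vol_scale r0 (measurable_open_ball hN 0 r); rewrite e -(vol_unit_ball hN) => h.
rewrite EFinM fineK; last first.
  by rewrite ge0_fin_numE// (vol_unit_ball hN) vol_open_ball_ltoo.
by rewrite h muleA -EFinM divff ?mul1e// gt_eqF// exprn_gt0.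
Qed.

Lemma vol_ball_diff_polar (x y : V) (r : R) : 0 < r ->
  (vol (ball_diff N x y r) <= (r ^+ n.+1 * (r^-1 * pN (x - y)))%:E)%E.
Proof.
move=> r0; have [->|xy] := eqVneq x y.
  by rewrite /ball_diff setDv measure0 subrr polar0 !mulr0.
have -> : vol (ball_diff N x y r) = vol (ball_diff N (x - y) 0 r).
  by rewrite -[RHS](vol_ball_diff_shift hN _ _ _ y) subrK add0r.
have -> : ball_diff N (x - y) 0 r =
    ball_diff N (r *: (r^-1 *: (x - y))) (r *: 0) (r * 1).
  by rewrite scaler0 mulr1 scalerA divff ?scale1r// gt_eqF.
rewrite (vol_ball_diff_scale hN)// EFinM lee_pmul2l// ?lte_fin ?exprn_gt0//.
by apply: vol_ball_diff_le; rewrite ?subr_eq0// invr_gt0.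
Qed.

Lemma exists_separating_partition (Delta : {posnum R}) :
  exists P : random_partition (fun x y => N (x - y)),
    bounded_partition Delta%:num P /\
    forall x y, (Delta%:num%:E *
      rp_prob P [set w | cluster_at (P := P) w x <> cluster_at (P := P) w y] <=
      (4 * pN (x - y) / ballvol)%:E)%E.
Proof.
pose r := Delta%:num / 2; have r0 : 0 < r by rewrite divr_gt0.
have [L L0 sepL] := exists_lattice_scale r0.
exists (ball_partition hN r0 L0 sepL); split.
  have := @ball_partition_bounded _ _ _ _ _ hN r0 L0 sepL.
  by rewrite /r mulrC divfK.
move=> x y; have := @ball_partition_separation _ _ _ _ _ hN r0 L0 sepL x y.
set p := rp_prob _ _.
have pfin : p = (fine p)%:E.
  rewrite fineK// /p cluster_at_separated; apply: fin_num_measure.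
  by apply: measurable_resample; exact: measurable_separated.
rewrite pfin (vol_open_ball_scale r0) -!EFinM => /le_trans h.
have {h} := h _ (leeD (vol_ball_diff_polar x y r0) (vol_ball_diff_polar y x r0)).
have -> : pN (y - x) = pN (x - y) by rewrite -polarN opprB.
rewrite -EFinD !lee_fin; set q := pN (x - y); set e := fine p => h.
have h' : ballvol * e <= r^-1 * q + r^-1 * q.
  by rewrite -(@ler_pM2l _ (r ^+ n.+1)) ?exprn_gt0// mulrA mulrDr.
rewrite ler_pdivlMr ?ballvol_gt0// (_ : Delta%:num = 2 * r); last by rewrite /r; field.
apply: (@le_trans _ _ (2 * r * (ballvol * e))).
  by rewrite le_eqVlt; apply/orP; left; apply/eqP; ring.
apply: (@le_trans _ _ (2 * r * (r^-1 * q + r^-1 * q))).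
  by rewrite ler_pM2l// mulr_gt0.
rewrite le_eqVlt; apply/orP; left; apply/eqP; field.
by rewrite gt_eqF.
Qed.

Lemma polar_metric : is_metric (fun x y : V => 4 * pN (x - y) / ballvol).
Proof.
have v0 := ballvol_gt0.
have k0 : 0 < 4 / ballvol by rewrite divr_gt0.
have E x : 4 * pN x / ballvol = 4 / ballvol * pN x by rewrite mulrAC.
split=> [x y|x y|x y|x y z]; rewrite ?E.
- by rewrite mulr_ge0 ?polar_ge0// ltW.
- split=> [h|->]; last by rewrite subrr polar0 mulr0.
  apply/eqP; rewrite -subr_eq0; apply/negPn/negP => /(polar_gt0 hN) xy0.
  by have := mulr_gt0 k0 xy0; rewrite h ltxx.
- by rewrite -polarN opprB.
- rewrite -mulrDr ler_pM2l// -(subrKA y).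
  exact: polarD.
Qed.

End profile.

Theorem theorem75 (R : realType) (n : nat) (N : 'rV[R]_n.+1 -> R) :
  is_norm N ->
  separation_profile (fun x y : 'rV[R]_n.+1 => N (x - y))
    (fun x y : 'rV[R]_n.+1 =>
       4 * polar_projection_norm N (x - y) / fine (vol (unit_ball N))).
Proof.
move=> hN; split; first exact: polar_metric.
have [P hP] := choice (exists_separating_partition hN).
exists P; split=> [Delta|x y]; first by have [] := hP Delta.
apply: ge_ereal_sup => _ [Delta _ <-].
by have [_ ] := hP Delta; apply.
Qed.
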